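(* Let $(G,+)$ be a compact topological group with a metric $d$ (inducing its topology), let $\sigma:\Omega\to\Omega$ be a topologically transitive two-sided subshift of finite type, let $\alpha\in(0,1]$, and let $f,g\in\mathcal{H}_\alpha(\Omega,\operatorname{Lip}(G))$. Suppose that $f$ and $g$ induce su-dominated cocycles over $\sigma$ and that for every $n\ge 1$ and every $x_0\in\Omega$ with $\sigma^n(x_0)=x_0$ one has $f^n_{x_0}=g^n_{x_0}$. Then there exist $\beta$ with $0<\beta<\alpha^2$ and a $\beta$-Hölder map $\phi:\Omega\to(\mathcal{H}_\beta(G),d_\infty)$, $x\mapsto\phi_x$, such that $$f_x=\phi_{\sigma(x)}\circ g_x\circ\phi_x^{-1}\qquad\text{for all }x\in\Omega.$$
   Context: Base. $P=(P_{i,j})_{1\le i,j\le k}$ is a matrix with entries in $\{0,1\}$ and no null row, $\Omega=\{(x_n)_{n\in\mathbb Z}\in\{1,\dots,k\}^{\mathbb Z}: P_{x_n,x_{n+1}}=1\ \forall n\in\mathbb Z\}$, and $\sigma((x_n)_n)=(x_{n+1})_n$. A constant $\rho>1$ is fixed and $d_\Omega(x,y)=\rho^{-N_{x,y}}$ with $N_{x,y}=\max\{N\ge 0: x_n=y_n\text{ for all }|n|<N\}$ (and $d_\Omega(x,x)=0$). Fibre maps. $\operatorname{Hom}(G)$ is the set of homeomorphisms of $G$ onto itself. $\mathcal{H}_\beta(G)\subset\operatorname{Hom}(G)$ is the set of $\beta$-Hölder homeomorphisms whose inverses are also $\beta$-Hölder; $\operatorname{Lip}(G)$ is the case $\beta=1$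 (bi-Lipschitz homeomorphisms). $d_\infty(u,v)=\sup_{p\in G}d(u(p),v(p))$. $L(u)$ denotes the (best) Lipschitz constant of $u$. The Lipschitz metric on $\operatorname{Lip}(G)$ is $d_1(u,v)=d_\infty(u,v)+L(u-v)$, where $u-v$ is the pointwise difference in $(G,+)$. Cocycles. $\mathcal{H}_\alpha(\Omega,\operatorname{Lip}(G))$ is the set of $\alpha$-Hölder maps $x\mapsto f_x$ from $(\Omega,d_\Omega)$ to $(\operatorname{Lip}(G),d_1)$. The induced cocycle has iterates $f^n_x=f_{\sigma^{n-1}(x)}\circ\cdots\circ f_x$ for $n\ge1$. Domination. The cocycle of $f\in\mathcal{H}_\alpha(\Omega,\operatorname{Lip}(G))$ is su-dominated if there is $\theta>0$ such that $L(f_x^{-1})<\rho^{\alpha-\theta}$ and $L(f_x)<\rho^{\alpha-\theta}$ for all $x\in\Omega$. *)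

(* Defs.v *)
From HB Require Import structures.
From mathcomp Require Import all_boot all_order all_algebra.
From mathcomp Require Import all_classical all_reals all_analysis.

Set Implicit Arguments.
Unset Strict Implicit.
Unset Printing Implicit Defensive.

Import Order.TTheory GRing.Theory Num.Theory.

Local Open Scope classical_set_scope.
Local Open Scope ring_scope.

(* Topological groups, not assumed commutative. The group law, written
   additively (G, +) in the mathematical text, is the multiplicative law of
   MathComp's [groupType]. *)
HB.mixin Record Group_isTopological G of Group G & Topological G := {
  mulg_continuous : continuous (fun p : G * G => (p.1 * p.2)%g) ;
  invg_continuous : continuous (fun p : G => (p^-1)%g)
}.

(* A topological group whose topology is the one induced by the metric
   [mdist]; no invariance of [mdist] under translations is required. *)
#[short(type="metricGroupType")]
HB.structure Definition MetricGroup (R : numDomainType) :=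
  { G of Metric R G & Group G & Group_isTopological G }.

Section Subshift.
Variables (R : realType) (k : nat) (P : 'M[bool]_k).

Definition sft : set (int -> 'I_k) :=
  [set x | forall n : int, P (x n) (x (n + 1))].

Fact sft_shift_subproof (x : sft) : (fun n : int => val x (n + 1)) \in sft.
Proof. by apply/mem_set => n; have /set_mem := valP x; apply. Qed.

Definition sft_shift (x : sft) : sft :=
  exist (fun z => z \in sft) _ (sft_shift_subproof x).

Definition agree (x y : sft) (N : nat) : Prop :=
  forall n : int, (absz n < N)%N -> val x n = val y n.

(* The maximum exists as soon as x <> y; the default value of [xget] is then
   never used. *)
Definition agree_max (x y : sft) : nat :=
  xget 0%N [set N | agree x y N /\ forall M, agree x y M -> (M <= N)%N].

Definition sft_dist (rho : R) (x y : sft) : R :=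
  if `[< x = y >] then 0 else rho ^- agree_max x y.

End Subshift.

Section MetricNotions.
Variable R : realType.

Definition metric_open (X : Type) (dX : X -> X -> R) (U : set X) : Prop :=
  forall x, U x -> exists2 e : R, 0 < e & forall y, dX x y < e -> U y.

(* Transitivity in forward time: with n ranging over all integers, shifts such
   as the one of the matrix (1 1; 0 1) would also qualify. *)
Definition topologically_transitive (X : Type) (dX : X -> X -> R)
    (T : X -> X) : Prop :=
  forall U V : set X, metric_open dX U -> metric_open dX V ->
    U !=set0 -> V !=set0 -> exists n : nat, (iter n T @` U) `&` V !=set0.

Definition holder (X Y : Type) (dX : X -> X -> R) (dY : Y -> Y -> \bar R)
    (a : R) (h : X -> Y) : Prop :=
  exists C : R, forall x y, (dY (h x) (h y) <= (C * dX x y `^ a)%:E)%E.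

End MetricNotions.

Section FibreMaps.
Variables (R : realType) (G : metricGroupType R).

Record homeo := Homeo {
  homeo_fun :> G -> G ;
  homeo_inv : G -> G ;
  homeo_funK : cancel homeo_fun homeo_inv ;
  homeo_invK : cancel homeo_inv homeo_fun ;
  homeo_fun_continuous : continuous homeo_fun ;
  homeo_inv_continuous : continuous homeo_inv
}.

Definition holder_fibre (b : R) (u : G -> G) : Prop :=
  holder (@mdist R G) (fun p q => (mdist p q)%:E) b u.

Definition holder_homeo (b : R) : set homeo :=
  [set u : homeo | holder_fibre b u /\ holder_fibre b (homeo_inv u)].

Definition lip_homeo : set homeo := holder_homeo 1.

Definition dist_sup (u v : G -> G) : \bar R :=
  ereal_sup (range (fun p => (mdist (u p) (v p))%:E)).

(* +oo when u is not Lipschitz. *)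
Definition lip_const (u : G -> G) : \bar R :=
  ereal_inf [set K%:E | K in
    [set K : R | 0 <= K /\
                 forall p q, mdist (u p) (u q) <= K * mdist p q]].

(* May be +oo on lip_homeo: the metric is arbitrary, so the difference of two
   Lipschitz maps need not be Lipschitz. *)
Definition dist_lip (u v : G -> G) : \bar R :=
  (dist_sup u v + lip_const (fun p => (u p * (v p)^-1)%g))%E.

End FibreMaps.

Section Cocycles.
Variables (R : realType) (k : nat) (P : 'M[bool]_k) (rho : R).
Variable G : metricGroupType R.

(* Membership in H_alpha(Omega, Lip(G)). *)
Definition holder_cocycle (alpha : R) (f : sft P -> homeo G) : Prop :=
  (forall x, lip_homeo (f x)) /\
  holder (sft_dist rho) (fun u v : homeo G => dist_lip u v) alpha f.

Fixpoint cocycle_iter (f : sft P -> homeo G) (n : nat) (x : sft P) : G -> G :=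
  if n is m.+1 then f (iter m (@sft_shift k P) x) \o cocycle_iter f m x else id.

Definition su_dominated (alpha : R) (f : sft P -> homeo G) : Prop :=
  exists2 theta : R, 0 < theta &
    forall x, (lip_const (homeo_inv (f x)) < (rho `^ (alpha - theta))%:E)%E /\
              (lip_const (f x) < (rho `^ (alpha - theta))%:E)%E.

End Cocycles.

(* Main.v *)
Require Import Defs.
From HB Require Import structures.
From mathcomp Require Import all_boot all_order all_algebra.
From mathcomp Require Import zify lra ring.
From mathcomp Require Import all_classical all_reals all_analysis.

(** Domination makes the products [(f^n_y)^-1 o f^n_x] along asymptotic orbits
    converge geometrically fast to a holonomy; as these products are Lipschitz
    with exponentially growing constants, the holonomy is Hölder by
    interpolation. Fix a periodic point [q]. For a point [z] asymptotic to the
    orbit of [q] in both time directions, the limits of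
    [f^n_{s^-n z} o (g^n_{s^-n z})^-1] and of [(f^n_z)^-1 o g^n_z], taken along
    the times at which [z] is in phase with [q], both exist, because [f] and
    [g] have the same return map at [q]. They coincide: closing up the orbit of
    [z] far out gives periodic points, where the products of [f] and [g] agree.
    Call the common value [phi_z]. Passing from [z] to a nearby point through
    the point with the past of one and the future of the other shows that
    [phi] is uniformly Hölder in the fibre, by comparison with one point per
    symbol, and Hölder in [z]. By transitivity such points are dense, and [phi]
    extends to the whole subshift. *)

Set Implicit Arguments.
Unset Strict Implicit.
Unset Printing Implicit Defensive.

Import Order.TTheory GRing.Theory Num.Theory.

Local Open Scope classical_set_scope.
Local Open Scope ring_scope.

(** * Uniform convergence of Hölder maps *)

Lemma geometric_small (R : realType) (C k e : R) : 0 <= C -> 0 <= k < 1 ->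
  0 < e -> exists N, forall n, (N <= n)%N -> C * k ^+ n <= e.
Proof.
move=> C0 /andP[k0 k1] e0.
have /cvgrPdist_le /(_ _ e0) [N _ HN] : geometric C k x @[x --> \oo] --> 0.
  by apply: cvg_geometric; rewrite ger0_norm.
exists N => n /HN /=; rewrite sub0r normrN ger0_norm//.
by rewrite mulr_ge0// exprn_ge0.
Qed.

Lemma geometric_large (R : realType) (k x : R) : 1 < k -> exists n, x < k ^+ n.
Proof.
move=> k1; have k0 : 0 < k by rewrite (lt_trans _ k1).
have k01 : 0 <= k^-1 < 1 by rewrite invr_ge0 ltW//= invf_lt1.
have h0 : 0 < 2^-1 :> R by rewrite invr_gt0.
have [N /(_ N (leqnn _))] := geometric_small (normr_ge0 x) k01 h0.
rewrite exprVn ler_pdivrMr ?exprn_gt0// => H.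
exists N; apply: (le_lt_trans (ler_norm x)); apply: (le_lt_trans H).
by rewrite gtr_pMl ?exprn_gt0// invf_lt1// ltr1n.
Qed.

Lemma powR_homo_base (R : realType) (b x y : R) :
  0 <= b -> 0 <= x -> x <= y -> x `^ b <= y `^ b.
Proof.
by move=> b0 x0 xy; apply: ge0_ler_powR; rewrite // nnegrE// (le_trans x0).
Qed.

Lemma powR_exprn (R : realType) (x b : R) n : 0 <= x ->
  (x ^+ n) `^ b = (x `^ b) ^+ n.
Proof.
by move=> x0; rewrite -(powR_mulrn n x0) -(powR_mulrn n (powR_ge0 x b)) powRAC.
Qed.

Section UniformConvergence.
Variables (R : realType) (T : metricType R).
Implicit Types (u v w : T -> T) (us vs ws : nat -> T -> T) (e K A b C k : R).

Definition uclose e u v := forall p, mdist (u p) (v p) <= e.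
Definition lip_with K u := forall p q, mdist (u p) (u q) <= K * mdist p q.
Definition holder_with A b u := forall p q, mdist (u p) (u q) <= A * mdist p q `^ b.
Definition ucvg us u :=
  forall e, 0 < e -> exists N, forall n, (N <= n)%N -> uclose e (us n) u.

Lemma uclose_refl u : uclose 0 u u.
Proof. by move=> p; rewrite mdistxx. Qed.

Lemma uclose_sym e u v : uclose e u v -> uclose e v u.
Proof. by move=> h p; rewrite metric_sym. Qed.

Lemma uclose_le e e' u v : e <= e' -> uclose e u v -> uclose e' u v.
Proof. by move=> ee' h p; apply: le_trans ee'. Qed.

Lemma uclose_trans e e' v u w :
  uclose e u v -> uclose e' v w -> uclose (e + e') u w.
Proof.
by move=> h h' p; apply: (le_trans (metric_triangle _ (v p) _)); apply: lerD.
Qed.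

Lemma uclose_compr e u v w : uclose e u v -> uclose e (u \o w) (v \o w).
Proof. by move=> h p; apply: h. Qed.

Lemma uclose_lip K e u v w : 0 <= K -> lip_with K w -> uclose e u v ->
  uclose (K * e) (w \o u) (w \o v).
Proof.
by move=> K0 hw h p; apply: (le_trans (hw _ _)); rewrite ler_wpM2l.
Qed.

Lemma uclose_holder A b e u v w : 0 <= A -> 0 <= b -> holder_with A b w ->
  uclose e u v -> uclose (A * e `^ b) (w \o u) (w \o v).
Proof.
move=> A0 b0 hw h p; apply: (le_trans (hw _ _)); rewrite ler_wpM2l//.
by apply: powR_homo_base => //; exact: mdist_ge0.
Qed.

Lemma lip_id : lip_with 1 id.
Proof. by move=> p q; rewrite mul1r. Qed.

Lemma lip_comp K K' u v : 0 <= K -> lip_with K u -> lip_with K' v ->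
  lip_with (K * K') (u \o v).
Proof.
move=> K0 hu hv p q; apply: (le_trans (hu _ _)).
by rewrite -mulrA ler_wpM2l.
Qed.

Lemma lip_le K K' u : K <= K' -> lip_with K u -> lip_with K' u.
Proof.
move=> KK h p q; apply: (le_trans (h p q)); rewrite ler_wpM2r//.
exact: mdist_ge0.
Qed.

Lemma lip_holder K u : lip_with K u -> holder_with K 1 u.
Proof. by move=> h p q; rewrite powRr1// mdist_ge0. Qed.

Lemma holder_le A A' b u : A <= A' -> holder_with A b u -> holder_with A' b u.
Proof.
by move=> AA h p q; apply: (le_trans (h p q)); rewrite ler_wpM2r// powR_ge0.
Qed.

Lemma holder_comp A A' b b' u v : 0 <= A -> 0 <= A' -> 0 <= b ->
  holder_with A b u -> holder_with A' b' v -> holder_with (A * A' `^ b) (b' * b) (u \o v).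
Proof.
move=> A0 A'0 b0 hu hv p q; apply: (le_trans (hu _ _)).
rewrite -mulrA ler_wpM2l// powRrM -powRM ?powR_ge0//.
by apply: powR_homo_base => //; exact: mdist_ge0.
Qed.

Lemma holder_small A b e : 0 <= A -> 0 < b -> 0 < e ->
  exists2 d, 0 < d & A * d `^ b <= e.
Proof.
move=> A0 b0 e0; exists ((e / (A + 1)) `^ b^-1).
  by rewrite powR_gt0// divr_gt0// ltr_wpDl.
rewrite -powRrM mulVf ?gt_eqF// powRr1; last by rewrite divr_ge0 ?ltW// ltr_wpDl.
rewrite mulrCA -[leRHS]mulr1 ler_wpM2l ?ltW//.
by rewrite ltr_pdivrMr ?ltr_wpDl// mul1r ltrDl.
Qed.

Lemma ucvg_cst u : ucvg (fun=> u) u.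
Proof. by move=> e e0; exists 0%N => n _ p; rewrite mdistxx ltW. Qed.

Lemma ucvg_geometric C k us u : 0 <= C -> 0 <= k < 1 ->
  (forall n, uclose (C * k ^+ n) (us n) u) -> ucvg us u.
Proof.
move=> C0 k01 h e e0; have [N HN] := geometric_small C0 k01 e0.
by exists N => n /HN; move/uclose_le; apply.
Qed.

Lemma ucvg_sub (s : nat -> nat) us u : (forall n, (n <= s n)%N) ->
  ucvg us u -> ucvg (us \o s) u.
Proof.
move=> hs h e /h [N HN]; exists N => n Nn; apply: HN.
exact: leq_trans Nn (hs n).
Qed.

Lemma ucvg_close e us vs u v : ucvg us u -> ucvg vs v ->
  (forall d, 0 < d -> exists n0, forall n, (n0 <= n)%N ->
     uclose (e + d) (us n) (vs n)) -> uclose e u v.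
Proof.
move=> hu hv h p; apply/ler_addgt0Pr => d d0.
have d3 : 0 < d / 3 by rewrite divr_gt0.
have [N1 H1] := hu _ d3; have [N2 H2] := hv _ d3; have [N3 H3] := h _ d3.
pose n := maxn N1 (maxn N2 N3).
have /(_ p) h1 : uclose (d / 3) (us n) u by apply: H1; rewrite /n; lia.
have /(_ p) h2 : uclose (d / 3) (vs n) v by apply: H2; rewrite /n; lia.
have /(_ p) h3 : uclose (e + d / 3) (us n) (vs n) by apply: H3; rewrite /n; lia.
have := metric_triangle (u p) (us n p) (v p).
have := metric_triangle (us n p) (vs n p) (v p).
rewrite (metric_sym (u p) (us n p)); lra.
Qed.

Lemma uclose0_eq u v : uclose 0 u v -> u = v.
Proof.
move=> h; apply/funext => p; apply: mdist_positivity.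
by apply/eqP; rewrite eq_le h mdist_ge0.
Qed.

Lemma ucvg_unique us u v : ucvg us u -> ucvg us v -> u = v.
Proof.
move=> hu hv; apply: uclose0_eq; apply: (ucvg_close hu hv) => d d0.
by exists 0%N => n _; apply: uclose_le (uclose_refl _); rewrite add0r ltW.
Qed.

Lemma ucvg_ext us vs u : (forall n, us n = vs n) -> ucvg us u -> ucvg vs u.
Proof. by move=> /funext ->. Qed.

Lemma ucvg_comp A b us ws u w : 0 <= A -> 0 < b -> holder_with A b u ->
  ucvg us u -> ucvg ws w -> ucvg (fun n => us n \o ws n) (u \o w).
Proof.
move=> A0 b0 hA hu hw e e0; have e2 : 0 < e / 2 by rewrite divr_gt0.
have [d d0 hd] := holder_small A0 b0 e2.
have [N1 H1] := hu _ e2; have [N2 H2] := hw _ d0.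
exists (maxn N1 N2) => n nN.
have -> : e = e / 2 + e / 2 by lra.
apply: (@uclose_trans _ _ (u \o ws n)).
  by apply: uclose_compr; apply: H1; lia.
apply: (uclose_le hd); apply: uclose_holder => //; first exact: ltW.
by apply: H2; lia.
Qed.

Lemma holder_ucvg A b us u : ucvg us u -> (forall n, holder_with A b (us n)) ->
  holder_with A b u.
Proof.
move=> hu h p q; apply/ler_addgt0Pr => d d0.
have d2 : 0 < d / 2 by rewrite divr_gt0.
have [n /(_ n (leqnn _)) hn] := hu _ d2.
have := h n p q; have := hn p; have := hn q.
have := metric_triangle (u p) (us n p) (u q).
have := metric_triangle (us n p) (us n q) (u q).
rewrite (metric_sym (u p) (us n p)); lra.
Qed.

(** * Consequences of compactness *)

Hypothesis T_compact : compact [set: T].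

Lemma compact_cluster_point (s : nat -> T) : exists c, forall e (N : nat), 0 < e ->
  exists2 n, (N <= n)%N & mdist c (s n) < e.
Proof.
have [c [_ hc]] : [set: T] `&` cluster (s x @[x --> \oo]) !=set0.
  by apply: T_compact; exact: filterT.
exists c => e N e0.
have [] := hc [set s n | n in [set n | (N <= n)%N]] (ball c e).
- by exists N => //= n Nn; exists n.
- exact: nbhsx_ballx.
- by move=> _ [[n Nn <-]]; rewrite ballEmdist/= => h; exists n.
Qed.

(** Points at distance more than n from a fixed [p0] would cluster at some [c]; one of them within 1
    of [c] with n > d(p0, c) + 1 contradicts the triangle inequality. *)
Lemma compact_diameter : exists2 D : R, 1 <= D & forall p q : T, mdist p q <= D.
Proof.
have [[p0 _]|h0] := pselect ([set: T] !=set0); last first.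
  by exists 1 => // p; exfalso; apply: h0; exists p.
have [[D hD]|hD] := pselect (exists D : R, forall p, mdist p0 p <= D).
  exists (1 + (D + D)) => [|p q].
    by rewrite lerDl addr_ge0// (le_trans (mdist_ge0 p0 p0)).
  have := metric_triangle p p0 q; have := hD p; have := hD q.
  rewrite (metric_sym p p0); lra.
have /choice[s hs] : forall n : nat, exists p, n%:R < mdist p0 p.
  move=> n; apply: contrapT => hn; apply: hD; exists n%:R => p.
  by rewrite leNgt; apply/negP => h; apply: hn; exists p.
have [c hc] := compact_cluster_point s.
have [n + hn] := hc 1 (Num.truncn (mdist p0 c + 1)).+1 ltr01.
have /andP[_ h1] := truncn_itv (addr_ge0 (mdist_ge0 p0 c) ler01).
rewrite -(ler_nat R) => /(lt_le_trans h1) => h2.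
have := hs n; have := metric_triangle p0 c (s n); lra.
Qed.

(** Completeness is drawn from compactness: the limit is chosen pointwise as a cluster point, and
    the telescoped bound, uniform in the point, makes the convergence uniform. *)
Lemma geometric_ucvg C k us : 0 <= C -> 0 <= k < 1 ->
  (forall n, uclose (C * k ^+ n) (us n) (us n.+1)) ->
  exists u, forall n, uclose (C / (1 - k) * k ^+ n) (us n) u.
Proof.
move=> C0 /andP[k0 k1] h.
have k1' : 0 < 1 - k by rewrite subr_gt0.
have hm n m p : mdist (us n p) (us (n + m)%N p) <=
    C / (1 - k) * (k ^+ n - k ^+ (n + m)).
  elim: m => [|m IH]; first by rewrite addn0 mdistxx subrr mulr0.
  rewrite addnS; apply: (le_trans (metric_triangle _ (us (n + m)%N p) _)).
  apply: (le_trans (lerD IH (h _ _))); rewrite exprS.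
  have -> : C * k ^+ (n + m) = C / (1 - k) * ((1 - k) * k ^+ (n + m)).
    by rewrite mulrA divfK// gt_eqF.
  by rewrite -mulrDr ler_wpM2l ?divr_ge0 ?(ltW k1')//; lra.
have /choice[u hu] := fun p => compact_cluster_point (fun n => us n p).
exists u => n p; apply/ler_addgt0Pr => e e0.
have [m nm /ltW hm'] := hu p e n e0.
apply: (le_trans (metric_triangle _ (us m p) _)); apply: lerD.
  rewrite -(subnKC nm); apply: (le_trans (hm _ _ _)).
  rewrite ler_wpM2l ?divr_ge0 ?(ltW k1')// gerBl.
  by rewrite exprn_ge0.
by rewrite metric_sym.
Qed.

(* At scale [d] the Lipschitz bound [K M^n d] and the uniform error [C l^n]
   balance for [(M/l)^n ~ 1/d], which gives the exponent
   [b = log (1/l) / log (M/l)]. *)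
Lemma holder_interpolation (M l : R) : 1 < M -> 0 < l < 1 ->
  exists2 b, 0 < b & forall C K, 0 <= C -> 0 <= K ->
    exists2 A, 0 <= A & forall us u, (forall n, uclose (C * l ^+ n) (us n) u) ->
      (forall n, lip_with (K * M ^+ n) (us n)) -> holder_with A b u.
Proof.
move=> M1 /andP[l0 l1]; have M0 : 0 < M by rewrite (lt_trans _ M1).
have [D D1 hD] := compact_diameter.
pose Q := M / l.
have Q0 : 0 < Q by rewrite divr_gt0.
have Q1 : 1 < Q by rewrite ltr_pdivlMr// mul1r (lt_trans l1).
have lnQ : 0 < ln Q by rewrite ln_gt0.
pose b := - ln l / ln Q.
have b0 : 0 < b by rewrite divr_gt0// oppr_gt0 ln_lt0// l0.
have Ql : Q `^ (- b) = l.
  rewrite /powR gt_eqF// /b mulNr divfK ?gt_eqF// opprK.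
  by rewrite lnK.
exists b => // C K C0 K0.
exists ((C + C + K) / l + D); first by rewrite addr_ge0 ?divr_ge0 ?addr_ge0 ?(ltW l0)// (le_trans ler01).
move=> us u hu hl p q.
set d := mdist p q.
have d0 : 0 <= d := mdist_ge0 _ _.
have [->|pq] := eqVneq p q.
  by rewrite mdistxx mulr_ge0 ?powR_ge0// addr_ge0 ?divr_ge0 ?addr_ge0 ?(ltW l0)// (le_trans ler01).
have {d0}d0 : 0 < d by rewrite mdist_gt0.
have [d1|d1] := leP 1 d.
  apply: (le_trans (hD _ _)).
  have h1 : 1 <= d `^ b by rewrite -(powRr0 d) ler_powR// ltW.
  rewrite mulrDl -[leLHS]add0r lerD//.
    by rewrite mulr_ge0 ?powR_ge0// divr_ge0 ?addr_ge0 ?(ltW l0).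
  by rewrite ler_peMr// (le_trans ler01).
(* The last scale at which [Q ^+ n * d <= 1]. The first inequality says [M ^+ n * d <= l ^+ n]; the
   second bounds [l ^+ n.+1] by [d ^ b], at the cost of a factor [1 / l]. *)
have [n hn1 hn2] : exists2 n, Q ^+ n * d <= 1 & 1 < Q ^+ n.+1 * d.
  have ex : exists n, 1 < Q ^+ n * d.
    have [n hn] := geometric_large d^-1 Q1.
    by exists n; rewrite -ltr_pdivrMr// div1r.
  case: (ex_minnP ex) => -[|n] hn hmin; first by rewrite expr0 mul1r ltNge (ltW d1) in hn.
  exists n => //; rewrite leNgt; apply/negP => /hmin; by rewrite ltnn.
have QlM : Q ^+ n = M ^+ n / l ^+ n by rewrite expr_div_n.
have h1 : M ^+ n * d <= l ^+ n.
  move: hn1; rewrite QlM mulrAC ler_pdivrMr ?exprn_gt0// mul1r//.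
have h2 : l ^+ n.+1 <= d `^ b.
  rewrite -{1}Ql -powR_exprn ?(ltW Q0)// powRN.
  rewrite -[_^-1]mul1r ler_pdivrMr ?powR_gt0 ?exprn_gt0//.
  rewrite -powRM ?exprn_ge0 ?(ltW d0) ?(ltW Q0)// mulrC.
  apply: (@le_trans _ _ (1 `^ b)); first by rewrite powR1.
  by apply: powR_homo_base; rewrite ?(ltW b0) ?(ltW hn2).
have h3 : l ^+ n <= d `^ b / l.
  by rewrite ler_pdivlMr// -exprSr.
have := hl n p q; have := hu n p; have := hu n q.
have := metric_triangle (u p) (us n p) (u q).
have := metric_triangle (us n p) (us n q) (u q).
rewrite (metric_sym (u p) (us n p)) -/d => e1 e2 e3 e4 e5.
apply: (@le_trans _ _ ((C + C + K) * l ^+ n)).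
  have : K * M ^+ n * d <= K * l ^+ n by rewrite -mulrA ler_wpM2l.
  rewrite !mulrDl; lra.
rewrite [leRHS]mulrDl -[leLHS]addr0 lerD//.
  by rewrite mulrAC -mulrA ler_wpM2l ?addr_ge0.
by rewrite mulr_ge0 ?powR_ge0// (le_trans ler01).
Qed.

(** Split d^b as d^(b-b') d^b' and bound the first factor by the diameter; [B] then serves all maps
    at once. *)
Lemma holder_exponent_le b b' : b' <= b -> 0 < b' -> exists2 B, 0 <= B &
  forall A u, 0 <= A -> holder_with A b u -> holder_with (A * B) b' u.
Proof.
move=> bb b'0; have [D D1 hD] := compact_diameter.
exists (D `^ (b - b')) => [|A u A0 h p q]; first exact: powR_ge0.
apply: (le_trans (h p q)); rewrite -mulrA ler_wpM2l//.
have -> : mdist p q `^ b = mdist p q `^ (b - b') * mdist p q `^ b'.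
  by rewrite -powRD subrK// gt_eqF// (lt_le_trans b'0).
rewrite ler_wpM2r ?powR_ge0//; apply: powR_homo_base; rewrite ?subr_ge0//.
exact: mdist_ge0.
Qed.

End UniformConvergence.

(** * Holonomies of non-autonomous products *)

Section Holonomies.
Variables (R : realType) (G : metricGroupType R).
Implicit Types (a b c : nat -> homeo G) (M C d : R).

Definition homeo_sym (h : homeo G) : homeo G :=
  Homeo (homeo_invK h) (homeo_funK h)
    (@homeo_inv_continuous _ _ h) (@homeo_fun_continuous _ _ h).

Fixpoint comp_seq a n : G -> G :=
  if n is m.+1 then a m \o comp_seq a m else id.

Fixpoint inv_seq a n : G -> G :=
  if n is m.+1 then inv_seq a m \o homeo_inv (a m) else id.

(** For the fibre maps [a], [b] along the orbits of y and x this is (f^n_y)^-1 o f^n_x. The two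
    sequences may also come from two cocycles over the same orbit. *)
Definition holo a b n : G -> G := inv_seq a n \o comp_seq b n.

Lemma comp_seqK a n : cancel (comp_seq a n) (inv_seq a n).
Proof. by elim: n => [|n IH] p //=; rewrite homeo_funK IH. Qed.

Lemma inv_seqK a n : cancel (inv_seq a n) (comp_seq a n).
Proof. by elim: n => [|n IH] p //=; rewrite IH homeo_invK. Qed.

Lemma holo_id a n : holo a a n = id.
Proof. by apply/funext => p; exact: comp_seqK. Qed.

Lemma holo_comp b a c n : holo a b n \o holo b c n = holo a c n.
Proof. by apply/funext => p; rewrite /holo /= inv_seqK. Qed.

Lemma holoK a b n p : holo a b n (holo b a n p) = p.
Proof.
by have /(congr1 (fun u => u p)) := holo_comp b a a n; rewrite holo_id.
Qed.

Lemma comp_seqD a n m :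
  comp_seq a (n + m) = comp_seq (fun i => a (n + i)%N) m \o comp_seq a n.
Proof. by elim: m => [|m IH]; rewrite ?addn0// addnS /= IH. Qed.

Lemma inv_seqD a n m :
  inv_seq a (n + m) = inv_seq a n \o inv_seq (fun i => a (n + i)%N) m.
Proof. by elim: m => [|m IH]; rewrite ?addn0// addnS /= IH. Qed.

Lemma holoD a b n m : holo a b (n + m) =
  inv_seq a n \o holo (fun i => a (n + i)%N) (fun i => b (n + i)%N) m
    \o comp_seq b n.
Proof. by rewrite /holo comp_seqD inv_seqD. Qed.

Definition bilip M (h : homeo G) := lip_with M h /\ lip_with M (homeo_inv h).

Lemma lip_comp_seq M a n : 0 <= M -> (forall i, bilip M (a i)) ->
  lip_with (M ^+ n) (comp_seq a n).
Proof.
move=> M0 ha; elim: n => [|n IH]; first exact: lip_id.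
by rewrite exprS; apply: lip_comp => //; case: (ha n).
Qed.

Lemma lip_inv_seq M a n : 0 <= M -> (forall i, bilip M (a i)) ->
  lip_with (M ^+ n) (inv_seq a n).
Proof.
move=> M0 ha; elim: n => [|n IH]; first exact: lip_id.
by rewrite exprSr; apply: lip_comp; rewrite ?exprn_ge0//; case: (ha n).
Qed.

Lemma uclose_homeo_inv M d (h k : homeo G) : 0 <= M -> bilip M h -> uclose d h k ->
  uclose (M * d) (homeo_inv h) (homeo_inv k).
Proof.
move=> M0 [_ hM] hk p; have := uclose_lip M0 hM (uclose_sym hk) (homeo_inv k p).
by rewrite /= homeo_funK homeo_invK.
Qed.

(** Consecutive products differ by an inserted factor a_n^-1 b_n, which is [M * d]-close to the
    identity; the inverse product in front stretches this by at most [M ^+ n]. *)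
Lemma holo_step M a b d n : 0 <= M -> (forall i, bilip M (a i)) ->
  uclose d (a n) (b n) -> uclose (M ^+ n.+1 * d) (holo a b n) (holo a b n.+1).
Proof.
move=> M0 ha hd p; rewrite /holo /= exprSr -mulrA.
apply: (le_trans (lip_inv_seq n M0 ha _ _)); rewrite ler_wpM2l ?exprn_ge0//.
have := uclose_lip M0 (ha n).2 hd (comp_seq b n p).
by rewrite /= homeo_funK.
Qed.

(** * Estimates under domination, [M * t < 1] *)

Section Contraction.
Variables (M t : R).
Hypotheses (M1 : 1 < M) (t0 : 0 < t) (Mt1 : M * t < 1).

Let M0 : 0 < M. Proof. exact: lt_trans M1. Qed.
Let t1 : t < 1. Proof. by apply: lt_trans Mt1; rewrite ltr_pMl. Qed.
Let sMt : 0 < 1 - M * t. Proof. by rewrite subr_gt0. Qed.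
Let st : 0 < 1 - t. Proof. by rewrite subr_gt0. Qed.

(** The errors decay along the sequence, so the steps are bounded by C M (M t)^i t^N and sum to a
    bound independent of [n]. The factor [1 - (M * t) ^+ n] in the stronger claim is the exact
    partial sum. *)
Lemma holo_near a b C N n : 0 <= C -> (forall i, bilip M (a i)) ->
  (forall i, (i < n)%N -> uclose (C * t ^+ (N + i)) (a i) (b i)) ->
  uclose (C * M / (1 - M * t) * t ^+ N) (holo a b n) id.
Proof.
move=> C0 ha hab.
suff : uclose (C * M / (1 - M * t) * t ^+ N * (1 - (M * t) ^+ n)) (holo a b n) id.
  apply: uclose_le; rewrite -[leRHS]mulr1 ler_wpM2l//.
    by rewrite !mulr_ge0 ?invr_ge0 ?exprn_ge0 ?(ltW M0) ?(ltW sMt) ?(ltW t0).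
  by rewrite gerBl exprn_ge0// mulr_ge0 ?ltW.
elim: n hab => [|n IH] hab; first by move=> p; rewrite subrr mulr0 /holo/= mdistxx.
have h1 := IH (fun i ni => hab i (ltnW ni)).
have h2 := holo_step (ltW M0) ha (hab n (leqnn _)).
apply: uclose_le (uclose_trans (uclose_sym h2) h1).
rewrite exprD !exprS !exprMn.
set X := M ^+ n; set Y := t ^+ n; set Z := t ^+ N.
have -> : M * X * (C * (Z * Y)) = C * M / (1 - M * t) * Z * ((1 - M * t) * (X * Y)).
  by field; rewrite gt_eqF.
by rewrite -mulrDr le_eqVlt; apply/orP; left; apply/eqP; congr (_ * _); ring.
Qed.

(** Here the errors are largest at the end, where the expansion is largest too. The factor [M ^+ n]
    remains, and the bound is useful when [r] is comparable to [n]. *)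
Lemma holo_far a b C r n : 0 <= C -> (forall i, bilip M (a i)) ->
  (forall i, (i < n)%N -> uclose (C * t ^+ (r + (n - i))) (a i) (b i)) ->
  uclose (C * M / (1 - t) * M ^+ n * t ^+ r) (holo a b n) id.
Proof.
move=> C0 ha; elim: n r => [|n IH] r hab.
  move=> p; rewrite /holo/= mdistxx.
  by rewrite !mulr_ge0 ?invr_ge0 ?exprn_ge0 ?(ltW M0) ?(ltW st) ?(ltW t0).
(* Dropping the last factor moves the remaining ones one unit further from the end, so the induction
   hypothesis is used with [r.+1]. *)
have h1 : uclose (C * M / (1 - t) * M ^+ n * t ^+ r.+1) (holo a b n) id.
  apply: IH => i ni; apply: uclose_le (hab i (ltnW ni)).
  by rewrite subSn ?(ltnW ni)// addnS.
have := hab n (leqnn _); rewrite subSnn => /(holo_step (ltW M0) ha) h2.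
apply: uclose_le (uclose_trans (uclose_sym h2) h1).
rewrite addn1 !exprS.
set X := M ^+ n; set Y := t ^+ r.
have X0 : 0 <= X by rewrite exprn_ge0 ?ltW.
have Y0 : 0 <= Y by rewrite exprn_ge0 ?ltW.
rewrite -subr_ge0.
have -> : C * M / (1 - t) * (M * X) * Y - (M * X * (C * (t * Y)) + C * M / (1 - t) * X * (t * Y))
  = C * M * X * Y / (1 - t) * ((M - 1) + (1 - t) * (1 - t)).
  by field; rewrite gt_eqF.
have h3 : 0 <= (M - 1) + (1 - t) * (1 - t).
  by apply: addr_ge0; rewrite ?mulr_ge0 ?(ltW st)// subr_ge0 ltW.
by rewrite !mulr_ge0 ?invr_ge0 ?(ltW M0) ?(ltW st).
Qed.

Hypothesis G_compact : compact [set: G].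

(** The steps are of order (M t)^n while the n-th product is (M M)^n-Lipschitz, so interpolation
    applies. The exponent is fixed before [C], and [A] before the sequences, which gives the
    uniformity over orbits used later. *)
Lemma holo_limit : exists2 e : R, 0 < e & forall C, 0 <= C ->
  exists2 A : R, 0 <= A & forall a b,
    (forall i, bilip M (a i)) -> (forall i, bilip M (b i)) ->
    (forall i, uclose (C * t ^+ i) (a i) (b i)) ->
    exists2 h, holder_with A e h & ucvg (holo a b) h.
Proof.
have MM1 : 1 < M * M by rewrite -[ltLHS]mulr1 ltr_pM.
have Mt01 : 0 < M * t < 1 by rewrite mulr_gt0.
have [e e0 he] := holder_interpolation G_compact MM1 Mt01.
exists e => // C C0.
have K0 : 0 <= C * M / (1 - M * t) by rewrite !mulr_ge0 ?invr_ge0 ?(ltW M0) ?(ltW sMt).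
have [A A0 hA] := he _ 1 K0 ler01.
exists A => // a b ha hb hab.
have [|||h hh] := @geometric_ucvg _ _ G_compact (C * M) (M * t) (holo a b).
- by rewrite mulr_ge0 ?(ltW M0).
- by case/andP: Mt01 => /ltW -> ->.
- move=> n; apply: uclose_le (holo_step (ltW M0) ha (hab n)).
  by rewrite exprMn exprS; nra.
exists h.
  apply: (hA (holo a b)) => // n; rewrite mul1r exprMn.
  by apply: lip_comp; rewrite ?exprn_ge0 ?(ltW M0)//;
    [apply: lip_inv_seq|apply: lip_comp_seq]; rewrite ?(ltW M0).
apply: ucvg_geometric hh => //; by case/andP: Mt01 => /ltW -> ->.
Qed.

(* Along multiples of [l] the two reference sequences have the same products,
   so the products of [a] and [b] differ by two holonomies to them. *)
Lemma holo_periodic_limit : exists2 e : R, 0 < e & forall C, 0 <= C -> forall n,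
  exists2 A : R, 0 <= A & forall l a b a0 b0,
    (forall i, bilip M (a i)) -> (forall i, bilip M (b i)) ->
    (forall i, bilip M (a0 i)) -> (forall i, bilip M (b0 i)) ->
    (forall i, uclose (C * t ^+ i) (a (n + i)%N) (a0 i)) ->
    (forall i, uclose (C * t ^+ i) (b0 i) (b (n + i)%N)) ->
    (0 < l)%N -> (forall j, holo a0 b0 (j * l) = id) ->
    exists2 u, holder_with A e u & ucvg (fun j => holo a b (n + j * l)) u.
Proof.
have [e e0 he] := holo_limit.
(* One exponent per factor of the limit: the two finite products are Lipschitz, and the two
   holonomies have exponent [e]. *)
exists (1 * e * e * 1) => [|C C0 n]; first by rewrite !mulr_gt0.
have [A A0 hA] := he C C0.
have Mn0 : 0 <= M ^+ n by rewrite exprn_ge0 ?ltW.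
pose A1 := A * (M ^+ n) `^ e.
pose A2 := A * A1 `^ e.
have A10 : 0 <= A1 by rewrite mulr_ge0 ?powR_ge0.
have A20 : 0 <= A2 by rewrite mulr_ge0 ?powR_ge0.
exists (M ^+ n * A2 `^ 1); first by rewrite mulr_ge0 ?powR_ge0.
move=> l a b a0 b0 ha hb ha0 hb0 haa hbb l0 hid.
have [h1 H1 c1] := hA _ _ (fun i => ha (n + i)%N) ha0 haa.
have [h2 H2 c2] := hA _ _ hb0 (fun i => hb (n + i)%N) hbb.
have hinv := lip_holder (lip_inv_seq n (ltW M0) ha).
have hcomp := lip_holder (lip_comp_seq n (ltW M0) hb).
exists (inv_seq a n \o (h1 \o (h2 \o comp_seq b n))).
  by do 3!(apply: holder_comp => //; rewrite ?(ltW e0)//).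
have s j : (j <= j * l)%N by rewrite leq_pmulr.
pose w j := inv_seq a n \o (holo (fun i => a (n + i)%N) a0 (j * l) \o
  (holo b0 (fun i => b (n + i)%N) (j * l) \o comp_seq b n)).
apply: (@ucvg_ext _ _ w).
  move=> j; rewrite /w holoD.
  set a' := fun i => a (n + i)%N; set b' := fun i => b (n + i)%N.
  by rewrite -(holo_comp a0 a' b') -(holo_comp b0 a0 b') hid.
apply: (ucvg_comp Mn0 ltr01 hinv (@ucvg_cst _ _ _)).
apply: (ucvg_comp A0 e0 H1 (ucvg_sub s c1)).
apply: (ucvg_comp A0 e0 H2 (ucvg_sub s c2)).
exact: ucvg_cst.
Qed.

End Contraction.
End Holonomies.

(** * Subshifts of finite type *)

Section Symbolic.
Variables (k : nat) (P : 'M[bool]_k).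
Implicit Types (x y z w q p : sft P) (i m n : int).

Lemma sft_admissible x n : P (val x n) (val x (n + 1)).
Proof. by have /set_mem := valP x; apply. Qed.

Definition sft_mk (c : int -> 'I_k) (h : forall n, P (c n) (c (n + 1))) : sft P :=
  exist (fun s : int -> 'I_k => s \in sft P) c (mem_set h).

Lemma sft_ext x y : (forall i, val x i = val y i) -> x = y.
Proof. by move=> h; apply: val_inj; apply/funext. Qed.

Fact sh_subproof m x n : P (val x (n + m)) (val x (n + 1 + m)).
Proof. by rewrite addrAC; exact: sft_admissible. Qed.

Definition sh m x : sft P := sft_mk (sh_subproof m x).

Lemma shE m x i : val (sh m x) i = val x (i + m). Proof. by []. Qed.

Lemma sh_sh m n x : sh m (sh n x) = sh (m + n) x.
Proof. by apply: sft_ext => i; rewrite !shE addrA. Qed.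

Lemma sh0 x : sh 0 x = x.
Proof. by apply: sft_ext => i; rewrite !shE addr0. Qed.

Lemma sft_shiftE x : sft_shift x = sh 1 x.
Proof. exact: sft_ext. Qed.

Lemma iter_sft_shift (n : nat) x : iter n (@sft_shift k P) x = sh n x.
Proof.
elim: n => [|n IH]; first by rewrite sh0.
by rewrite iterS IH sft_shiftE sh_sh; congr sh; lia.
Qed.

Lemma sft_glue x y : val x 0 = val y 0 -> exists z,
  (forall i, i <= 0 -> val z i = val x i) /\
  (forall i, 0 <= i -> val z i = val y i).
Proof.
move=> xy; pose c i := if (i <= 0) then val x i else val y i.
have hc n : P (c n) (c (n + 1)).
  rewrite /c; case: ifP => h1; case: ifP => h2; try exact: sft_admissible.
    have -> : n = 0 by lia.
    by rewrite xy; exact: sft_admissible.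
  lia.
exists (sft_mk hc); split => i i0 /=; first by rewrite /c i0.
rewrite /c; case: ifP => // i0'; have -> : i = 0 by lia.
exact: xy.
Qed.

(** Repeating the block w_0, ..., w_(L-1) is admissible, since its closing transition is w_(L-1) ->
    w_L = w_0. *)
Lemma sft_periodic w (L : nat) : (0 < L)%N -> val w 0 = val w L -> exists z,
  sh L z = z /\ forall i, 0 <= i <= L%:Z -> val z i = val w i.
Proof.
move=> L0 wL; pose c i := val w (i %% L)%Z.
have L0' : L%:Z != 0 by lia.
have hc n : P (c n) (c (n + 1)).
  rewrite /c -modzDml; have := modz_ge0 n L0'; have := @ltz_pmod n L L0.
  set j := (n %% L)%Z => jL j0; have [e|ne] := eqVneq (j + 1) L%:Z.
    by rewrite e modzz wL -e; exact: sft_admissible.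
  by rewrite modz_small; [exact: sft_admissible | lia].
exists (sft_mk hc); split => [|i /andP[i0 iL]].
  by apply: sft_ext => i /=; rewrite /c modzDr.
rewrite /= /c; have [->|ne] := eqVneq i L%:Z; first by rewrite modzz.
by rewrite modz_small//; lia.
Qed.

(** Pigeonhole: among k+1 consecutive symbols two coincide, and the block between them closes up. *)
Lemma sft_periodic_point x : exists q (l : nat), (0 < l)%N /\ sh l q = q.
Proof.
have /injectivePn : ~~ injectiveb (fun i : 'I_k.+1 => val x (i : nat)%:Z).
  by apply/negP => /injectiveP /leq_card; rewrite !card_ord ltnn.
move=> [i [j ij e]]; wlog lt_ij : i j ij e / (i < j)%N => [hw|].
  have [lt|lt|eq] := ltngtP (i : nat) j; first exact: (hw i j).
    by apply: (hw j i) => //; rewrite eq_sym.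
  by rewrite (val_inj eq) eqxx in ij.
have [||q [hq _]] := @sft_periodic (sh (i : nat) x) (j - i)%N.
- by rewrite subn_gt0.
- by rewrite !shE add0r e; congr (val x _); lia.
by exists q, (j - i)%N; rewrite subn_gt0.
Qed.

Definition past_at q z (n : nat) :=
  forall i, i <= 0 -> val z (i - n%:Z) = val q i.
Definition future_at q z (n : nat) :=
  forall i, 0 <= i -> val z (i + n%:Z) = val q i.

(** The block of [z] over [-(n+J), m+J] starts and ends with the symbol q_0, because [J] is a period
    of [q]; [p] repeats it. Just outside the block both [z] and [p] still follow [q] in the same
    phase, which extends the agreement to [-2J, 2J]. *)
Lemma heteroclinic_closing q z (n m J : nat) : (0 < J)%N ->
  (forall i, val q (i + J%:Z) = val q i) -> past_at q z n -> future_at q z m ->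
  exists p, sh (n + J + (m + J))%N%:Z p = p /\
    forall i, - (J + J)%N%:Z <= i <= (J + J)%N%:Z -> val z i = val p i.
Proof.
move=> J0 qJ zn zm; pose L := (n + J + (m + J))%N.
have [||p0 [p0L hp0]] := @sft_periodic (sh (- (n + J)%N%:Z) z) L.
- by rewrite /L; lia.
- rewrite !shE add0r /L.
  have -> : - (n + J)%N%:Z = - J%:Z - n%:Z by lia.
  rewrite zn; last by lia.
  have -> : (n + J + (m + J))%N%:Z + (- J%:Z - n%:Z) = J%:Z + m%:Z by lia.
  rewrite zm; last by lia.
  by rewrite -(qJ (- J%:Z)) addNr -[in RHS](add0r J%:Z) qJ.
pose p := sh (n + J)%N p0.
have pL : sh L p = p by rewrite /p sh_sh addrC -sh_sh p0L.
have pL' i : val p (i + L%:Z) = val p i by rewrite -shE pL.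
have mid i : - (n + J)%N%:Z <= i <= (m + J)%N%:Z -> val p i = val z i.
  by move=> hi; rewrite /p shE hp0; [rewrite shE; congr (val z _); lia|lia].
exists p; split => // i hi.
have [h1|h1] := leP i (- (n + J)%N%:Z).
  rewrite -pL' mid; last by rewrite /L; lia.
  have {1}-> : i = (i + n%:Z) - n%:Z by lia.
  rewrite zn; last by lia.
  have -> : i + L%:Z = (i + n%:Z + J%:Z + J%:Z) + m%:Z by rewrite /L; lia.
  by rewrite zm ?qJ//; lia.
have [h2|h2] := leP (m + J)%N%:Z i; last by rewrite mid//; lia.
rewrite -[in RHS](subrK L%:Z i) pL' mid; last by rewrite /L; lia.
have {1}-> : i = (i - m%:Z) + m%:Z by lia.
rewrite zm; last by lia.
have -> : i - L%:Z = (i - m%:Z - J%:Z - J%:Z) - n%:Z by rewrite /L; lia.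
rewrite zn; last by lia.
by rewrite -(qJ (i - m%:Z - J%:Z - J%:Z)) subrK -(qJ (i - m%:Z - J%:Z)) subrK.
Qed.

(** The local product structure: [z] is the bracket of [x] and [y]. The radius is positive because
    gluing needs a common symbol at 0. *)
Lemma heteroclinic_glue q x y (n m N : nat) : past_at q x n -> future_at q y m ->
  agree x y N.+1 -> exists z, [/\ past_at q z n, future_at q z m,
    forall i, i < N.+1%:Z -> val z i = val x i &
    forall i, - N.+1%:Z < i -> val z i = val y i].
Proof.
move=> xn ym xy; have [|z [z1 z2]] := @sft_glue x y; first exact: xy.
exists z; split=> i hi.
- by rewrite z1 ?xn//; lia.
- by rewrite z2 ?ym//; lia.
- by have [i0|i0] := leP i 0; [rewrite z1|rewrite z2 -?xy//; lia].
- by have [i0|i0] := leP 0 i; [rewrite z2|rewrite z1 ?xy//; lia].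
Qed.

(** The radius is 2J - i, written in the form r + (n - i) of the hypothesis of [holo_far], with r =
    J - m and n = m + J. *)
Lemma agree_forward_window z w (m J i : nat) :
  (forall j, - (J + J)%N%:Z <= j <= (J + J)%N%:Z -> val z j = val w j) ->
  (m <= J)%N -> (i < m + J)%N ->
  agree (sh i z) (sh i w) ((J - m) + (m + J - i)).
Proof. by move=> h mJ iJ j hj; rewrite !shE h//; lia. Qed.

Lemma agree_backward_window z w (n J i : nat) :
  (forall j, - (J + J)%N%:Z <= j <= (J + J)%N%:Z -> val z j = val w j) ->
  (n <= J)%N -> (i < n + J)%N ->
  agree (sh (- i.+1%:Z) z) (sh (- i.+1%:Z) w) ((J - n) + (n + J - i)).
Proof. by move=> h nJ iJ j hj; rewrite !shE h//; lia. Qed.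

Lemma agree_mono x y (N N' : nat) : (N' <= N)%N -> agree x y N -> agree x y N'.
Proof. by move=> NN h n nN; apply: h; exact: leq_trans nN NN. Qed.

Lemma agree_sym x y N : agree x y N -> agree y x N.
Proof. by move=> h n /h. Qed.

Lemma agree_trans y x z N : agree x y N -> agree y z N -> agree x z N.
Proof. by move=> h h' n nN; rewrite h// h'. Qed.

Lemma agree_maxP x y : x <> y -> agree x y (agree_max x y) /\
  forall N, agree x y N -> (N <= agree_max x y)%N.
Proof.
move=> xy; rewrite /agree_max; case: xgetP => [N _ //|nN].
have [i xi] : exists i, val x i <> val y i.
  by apply/existsNP => h; apply: xy; exact: sft_ext.
have ex : exists N, `[< agree x y N >] by exists 0%N; apply/asboolP.
have ub N : `[< agree x y N >] -> (N <= absz i)%N.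
  by move=> /asboolP h; rewrite leqNgt; apply/negP => /h.
case: (ex_maxnP ex ub) => N /asboolP hN hmax.
exfalso; apply: (nN N); split => // N' hN'; apply: hmax; exact/asboolP.
Qed.

(** * The metric of the subshift and transitivity *)

Variables (R : realType) (rho : R).
Hypothesis rho1 : 1 < rho.

Let rho0 : 0 < rho. Proof. exact: lt_trans rho1. Qed.

Lemma sft_dist_agree x y N : agree x y N -> 0 <= sft_dist rho x y <= rho ^- N.
Proof.
move=> h; rewrite /sft_dist; case: asboolP => [_|/agree_maxP[_ /(_ N h) hN]].
  by rewrite lexx invr_ge0 exprn_ge0 ?ltW.
rewrite invr_ge0 exprn_ge0 ?(ltW rho0)//= lef_pV2 ?posrE ?exprn_gt0//.
by rewrite ler_weXn2l// ltW.
Qed.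

Lemma sft_distP x y :
  x = y \/ exists2 N, sft_dist rho x y = rho ^- N & agree x y N.
Proof.
have [->|xy] := pselect (x = y); [by left|right].
exists (agree_max x y); last by case: (agree_maxP xy).
by rewrite /sft_dist; case: asboolP.
Qed.

Hypothesis sft_transitive :
  topologically_transitive (sft_dist rho) (@sft_shift k P).

Lemma cylinder_open (s : 'I_k) : metric_open (sft_dist rho)
  [set x : sft P | val x 0 = s].
Proof.
(* Agreement radius 0 means distance 1, so a distance below 1 forces equal symbols at 0. *)
move=> x /= xs; exists 1 => // y.
have [<-//|[[|N] -> hN]] := sft_distP x y; first by rewrite expr0 invr1 ltxx.
by move=> _; rewrite -xs hN.
Qed.

Lemma sft_path x y : exists w (n : nat), val w 0 = val x 0 /\ val w n = val y 0.
Proof.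
have [||n [_ [[w /= wx <-] wy]]] := sft_transitive
  (@cylinder_open (val x 0)) (@cylinder_open (val y 0)).
- by exists x.
- by exists y.
by exists w, n; split => //; move: wy; rewrite /= iter_sft_shift shE add0r.
Qed.

(** Concatenate the past of [q], a path from q_0 to x_(-N), the block of [x] over [-N, N], a path
    from x_N to q_0, and the future of [q]; [a], [b], [c], [d] are the successive gluings, and the
    last shift recentres the block of [x]. *)
Lemma heteroclinic_dense q x N : exists z (n m : nat),
  [/\ agree x z N, past_at q z n & future_at q z m].
Proof.
have [w [n [w0 wn]]] := sft_path q (sh (- N%:Z) x).
have [a [a1 a2]] := sft_glue (esym w0).
have [|b [b1 b2]] := @sft_glue (sh n a) (sh (- N%:Z) x).
  by rewrite -wn !shE add0r a2.
have [w' [n' [w'0 w'n]]] := sft_path (sh N x) q.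
have [|c [c1 c2]] := @sft_glue (sh (N + N)%N b) w'.
  by rewrite w'0 !shE b2; [rewrite shE; congr (val x _); lia|lia].
have [|d [d1 d2]] := @sft_glue (sh n' c) q.
  by rewrite -w'n !shE add0r c2.
exists (sh (- (n' + N)%:Z) d), (N + n)%N, (n' + N)%N; split.
- move=> i iN; rewrite shE d1; last by lia.
  rewrite shE c1; last by lia.
  by rewrite shE b2; [rewrite shE; congr (val x _); lia|lia].
- move=> i i0; rewrite shE d1; last by lia.
  rewrite shE c1; last by lia.
  rewrite shE b1; last by lia.
  rewrite shE -a1//; congr (val a _); lia.
- by move=> i i0; rewrite shE addrK d2.
Qed.

End Symbolic.

(** * Comparison of two cocycles with the same periodic data *)

(** The left factor [X] costs [d]. The right factor [Y] is paid through the Hölder modulus of the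
    limit [v], so no modulus uniform in j is asked of [vs]. *)
Lemma uclose_conj (R : realType) (T : metricType R) (us vs : nat -> T -> T)
    (u v : T -> T) (A e d : R) : 0 <= A -> 0 <= e ->
  ucvg us u -> ucvg vs v -> holder_with A e v ->
  (exists j0, forall j, (j0 <= j)%N -> exists X Y,
    [/\ us j = X \o vs j \o Y, uclose d X id & uclose d Y id]) ->
  uclose (d + A * d `^ e) u v.
Proof.
move=> A0 e0 hu hv hA [j0 H]; apply: (ucvg_close hu hv) => d' d'0.
have d2 : 0 < d' / 2 by rewrite divr_gt0.
have [j1 H1] := hv _ d2; exists (maxn j0 j1) => j hj.
have [|X [Y [-> hX hY]]] := H j; first by lia.
have hj1 : uclose (d' / 2) (vs j) v by apply: H1; lia.
have h1 := uclose_compr (vs j \o Y) hX.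
have h2 := uclose_compr Y hj1.
have h3 := uclose_holder A0 e0 hA hY.
have := uclose_trans (uclose_trans h1 h2) (uclose_trans h3 (uclose_sym hj1)).
by apply: uclose_le; lra.
Qed.

(** The product of [a'] and [b'] is that of [a] and [b] between two holonomies, [holo a' a] and
    [holo b b'], whose limits have exponent [e]. *)
Lemma holo_transport (R : realType) (G : metricGroupType R) (M t : R) :
  1 < M -> 0 < t -> M * t < 1 -> compact [set: G] ->
  exists2 e : R, 0 < e & forall C A e1 : R, 0 <= C -> 0 <= A -> 0 < e1 ->
  exists2 A' : R, 0 <= A' & forall (a b a' b' : nat -> homeo G) s u u',
    (forall i, bilip M (a i)) -> (forall i, bilip M (b i)) ->
    (forall i, bilip M (a' i)) -> (forall i, bilip M (b' i)) ->
    (forall i, uclose (C * t ^+ i) (a' i) (a i)) ->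
    (forall i, uclose (C * t ^+ i) (b i) (b' i)) ->
    (forall n, (n <= s n)%N) ->
    ucvg (holo a b \o s) u -> holder_with A e1 u -> ucvg (holo a' b' \o s) u' ->
    holder_with A' (e * e1 * e) u'.
Proof.
move=> M1 t0 Mt1 cG; have [e e0 he] := holo_limit M1 t0 Mt1 cG.
exists e => // C A e1 C0 A0 e10; have [B B0 hB] := he _ C0.
exists (B * (A * B `^ e1) `^ e); first by rewrite mulr_ge0 ?powR_ge0.
move=> a b a' b' s u u' ha hb ha' hb' haa hbb hs cu hu cu'.
have [h1 H1 c1] := hB _ _ ha' ha haa.
have [h2 H2 c2] := hB _ _ hb hb' hbb.
have -> : u' = h1 \o (u \o h2).
  apply: (ucvg_unique cu'); apply: (@ucvg_ext _ _ (fun n =>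
    (holo a' a \o s) n \o ((holo a b \o s) n \o (holo b b' \o s) n))).
    by move=> n /=; rewrite (holo_comp b) (holo_comp a).
  apply: (ucvg_comp B0 e0 H1 (ucvg_sub hs c1)).
  by apply: (ucvg_comp A0 e10 hu) => //; apply: ucvg_sub c2.
apply: holder_comp; rewrite ?mulr_ge0 ?powR_ge0 ?(ltW e0)//.
by apply: holder_comp; rewrite ?(ltW e10).
Qed.

Section CocycleProducts.
Variables (R : realType) (G : metricGroupType R) (k : nat) (P : 'M[bool]_k).
Implicit Types (f g : sft P -> homeo G) (x y z : sft P).

Definition fw f x (i : nat) : homeo G := f (sh i%:Z x).
(** Inverse maps read backwards: [holo (bw f z) (bw g z) n] is f^n_(s^-n z) o (g^n_(s^-n z))^-1, so
    one theory of [holo] covers both time directions. *)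
Definition bw f x (i : nat) : homeo G := homeo_sym (f (sh (- i.+1%:Z) x)).

Lemma cocycle_iterE f n x : cocycle_iter f n x = comp_seq (fw f x) n.
Proof. by elim: n => //= n ->; rewrite iter_sft_shift. Qed.

Lemma inv_seq_bw f n x : inv_seq (bw f x) n = comp_seq (fw f (sh (- n%:Z) x)) n.
Proof.
elim: n => [//|n IH].
have := comp_seqD (fw f (sh (- n.+1%:Z) x)) 1 n; rewrite add1n => ->.
rewrite [LHS]/= IH [comp_seq _ 1]/= /fw sh_sh add0r.
congr (comp_seq _ _ \o _); apply/funext => i; rewrite !sh_sh; congr (f (sh _ _)); lia.
Qed.

Lemma cocycle_iter_split f n m x : cocycle_iter f (n + m) (sh (- n%:Z) x) =
  comp_seq (fw f x) m \o inv_seq (bw f x) n.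
Proof.
rewrite cocycle_iterE comp_seqD inv_seq_bw; congr (comp_seq _ _ \o _).
apply/funext => i; rewrite /fw sh_sh; congr (f (sh _ _)); lia.
Qed.

Definition same_periodic_data f g := forall n x, (1 <= n)%N ->
  iter n (@sft_shift k P) x = x -> cocycle_iter f n x = cocycle_iter g n x.

Lemma same_periodic_data_sym f g :
  same_periodic_data f g -> same_periodic_data g f.
Proof. by move=> h n x n1 nx; rewrite h. Qed.

(** The periodic data enter here. The return maps of [f] and [g] at s^-n p agree; each is a past
    product followed by a future one, and cancelling the future product of [f] and the past product
    of [g] gives the equality. *)
Lemma holo_split f g p n m : same_periodic_data f g -> (1 <= n + m)%N ->
  sh (n + m)%N p = p ->
  holo (bw f p) (bw g p) n = holo (fw f p) (fw g p) m.
Proof.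
move=> fg nm1 pnm; have /fg : iter (n + m) (@sft_shift k P) (sh (- n%:Z) p) =
    sh (- n%:Z) p.
  by rewrite iter_sft_shift sh_sh addrC -sh_sh pnm.
move=> /(_ nm1); rewrite !cocycle_iter_split => h.
apply/funext => r; rewrite /holo /=.
apply: (can_inj (comp_seqK (fw f p) m)); rewrite inv_seqK.
have := congr1 (fun u => u (comp_seq (bw g p) n r)) h => /= ->.
by rewrite comp_seqK.
Qed.

Variables (M t C : R).
Hypotheses (M1 : 1 < M) (t0 : 0 < t) (Mt1 : M * t < 1) (C0 : 0 <= C).

Let M0 : 0 < M. Proof. exact: lt_trans M1. Qed.
Let t1 : t < 1. Proof. by apply: lt_trans Mt1; rewrite ltr_pMl. Qed.

(** For a dominated Hölder cocycle, [M] will be rho^(alpha - theta) and [t] will be rho^(-alpha), so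
    that M t = rho^(-theta) < 1. *)
Definition regular_cocycle f := (forall x, bilip M (f x)) /\
  forall x y N, agree x y N -> uclose (C * t ^+ N) (f x) (f y).

(** A common constant for both time directions: passing to inverses costs a factor [M]. *)
Let CM := C * M.
Let CM0 : 0 <= CM. Proof. by rewrite mulr_ge0 ?(ltW M0). Qed.

Lemma bilip_fw f x i : regular_cocycle f -> bilip M (fw f x i).
Proof. by case=> h _; exact: h. Qed.

Lemma bilip_bw f x i : regular_cocycle f -> bilip M (bw f x i).
Proof. by case=> /(_ (sh (- i.+1%:Z) x)) [h1 h2] _; split. Qed.

Lemma fw_agree f x y (i N : nat) : regular_cocycle f ->
  agree (sh i x) (sh i y) N -> uclose (CM * t ^+ N) (fw f x i) (fw f y i).
Proof.
move=> [_ h] /h; apply: uclose_le; rewrite /CM ler_wpM2r ?exprn_ge0 ?(ltW t0)//.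
by rewrite ler_peMr// ltW.
Qed.

Lemma bw_agree f x y (i N : nat) : regular_cocycle f ->
  agree (sh (- i.+1%:Z) x) (sh (- i.+1%:Z) y) N ->
  uclose (CM * t ^+ N) (bw f x i) (bw f y i).
Proof.
move=> [h1 h] /h hc; rewrite /CM mulrAC mulrC.
exact: uclose_homeo_inv (ltW M0) (h1 _) hc.
Qed.

Lemma fw_half f x y (N : nat) : regular_cocycle f ->
  (forall i : int, - N%:Z < i -> val x i = val y i) ->
  forall i, uclose (CM * t ^+ (N + i)) (fw f x i) (fw f y i).
Proof.
by move=> rf h i; apply: fw_agree => // j jN; rewrite !shE h//; lia.
Qed.

Lemma bw_half f x y (N : nat) : regular_cocycle f ->
  (forall i : int, i < N%:Z -> val x i = val y i) ->
  forall i, uclose (CM * t ^+ (N + i)) (bw f x i) (bw f y i).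
Proof.
by move=> rf h i; apply: bw_agree => // j jN; rewrite !shE h//; lia.
Qed.

(** * Transfer maps at points asymptotic to a periodic orbit *)

Variables (q : sft P) (l : nat).
Hypotheses (l0 : (0 < l)%N) (ql : sh l q = q).

Lemma sh_period j : sh (j * l)%N q = q.
Proof.
elim: j => [|j IH]; first by rewrite mul0n sh0.
by rewrite mulSn PoszD -sh_sh IH.
Qed.

Lemma val_period j (i : int) : val q (i + (j * l)%N) = val q i.
Proof. by rewrite -shE sh_period. Qed.

(** The two candidates for phi_z, read from the past and from the future along times in phase with
    [q]. They are relations; the limit is unique by [ucvg_unique]. *)
Definition umap f g z n u := ucvg (fun j => holo (bw f z) (bw g z) (n + j * l)) u.
Definition smap f g z n u := ucvg (fun j => holo (fw f z) (fw g z) (n + j * l)) u.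

Hypothesis G_compact : compact [set: G].

(** Over whole periods of [q] the products of [f] and [g] agree, by [holo_split] with one of its two
    times equal to 0, so [holo_periodic_limit] applies. The constant still depends on the phase
    [n]. *)
Lemma umap_smap_exist : exists2 e : R, 0 < e & forall n,
  exists2 A : R, 0 <= A & forall f g z, regular_cocycle f -> regular_cocycle g ->
    same_periodic_data f g ->
    (past_at q z n -> exists2 u, holder_with A e u & umap f g z n u) /\
    (future_at q z n -> exists2 u, holder_with A e u & smap f g z n u).
Proof.
have [e e0 he] := holo_periodic_limit M1 t0 Mt1 G_compact.
exists e => // n; have [A A0 hA] := he _ CM0 n.
exists A => // f g z rf rg fg.
have hid j : holo (fw f q) (fw g q) (j * l) = id /\
             holo (bw f q) (bw g q) (j * l) = id.
  case: j => [|j]; first by [].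
  have hl : (1 <= j.+1 * l)%N by rewrite muln_gt0.
  split.
    by rewrite -(@holo_split f g q 0 (j.+1 * l)%N)// sh_period.
  by rewrite (@holo_split f g q (j.+1 * l)%N 0) ?addn0// sh_period.
split => hz.
- have hb f' : regular_cocycle f' -> forall i,
      uclose (CM * t ^+ i) (bw f' z (n + i)%N) (bw f' q i).
    move=> rf' i; have : uclose (CM * t ^+ (0 + i)) (bw f' (sh (- n%:Z) z) i) (bw f' q i).
      by apply: bw_half => // j j0; rewrite shE hz// ltW.
    by rewrite /bw sh_sh; congr (uclose _ (homeo_inv (f' (sh _ _))) _); clear; lia.
  apply: (hA l _ _ (bw f q) (bw g q)) => //; try by move=> i; exact: bilip_bw.
  + exact: hb.
  + by move=> i; apply: uclose_sym; exact: hb.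
  + by move=> j; case: (hid j).
- have hb f' : regular_cocycle f' -> forall i,
      uclose (CM * t ^+ i) (fw f' z (n + i)%N) (fw f' q i).
    move=> rf' i; have : uclose (CM * t ^+ (0 + i)) (fw f' (sh n%:Z z) i) (fw f' q i).
      by apply: fw_half => // j j0; rewrite shE hz// ltW.
    by rewrite /fw sh_sh; congr (uclose _ (f' (sh _ _)) _); clear; lia.
  apply: (hA l _ _ (fw f q) (fw g q)) => //; try by move=> i; exact: bilip_fw.
  + exact: hb.
  + by move=> i; apply: uclose_sym; exact: hb.
  + by move=> j; case: (hid j).
Qed.

(** For r = J - n the bound of [holo_far] is (M t)^(J-n) times a constant depending on [n]. *)
Lemma far_small n (d : R) : 0 < d -> exists j0, forall J, (j0 <= J)%N ->
  (n <= J)%N /\ CM * M / (1 - t) * M ^+ (n + J) * t ^+ (J - n) <= d.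
Proof.
move=> d0; pose K := CM * M / (1 - t) * (M ^+ n * M ^+ n).
have K0 : 0 <= K.
  by rewrite !mulr_ge0 ?invr_ge0 ?exprn_ge0 ?(ltW M0) ?subr_ge0 ?(ltW t1).
have Mt01 : 0 <= M * t < 1 by rewrite mulr_ge0 ?(ltW M0) ?(ltW t0).
have [N HN] := geometric_small K0 Mt01 d0.
exists (n + N)%N => J hJ; split; first by clear -hJ; lia.
have /HN : (N <= J - n)%N by clear -hJ; lia.
rewrite /K exprMn => h; apply: le_trans h.
have -> : (n + J = n + n + (J - n))%N by clear -hJ; lia.
by rewrite !exprD le_eqVlt; apply/orP; left; apply/eqP; ring.
Qed.

(* The orbit of [z] leaves the orbit of [q] and returns to it; closing it up
   far out gives periodic points whose products compare both limits. *)
Lemma umap_smap_eq f g z n m u v : regular_cocycle f -> regular_cocycle g ->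
  same_periodic_data f g -> past_at q z n -> future_at q z m ->
  umap f g z n u -> smap f g z m v -> u = v.
Proof.
move=> rf rg fg zn zm hu hv.
have [A [e [A0 e0 hA]]] : exists A e : R, [/\ 0 <= A, 0 < e & holder_with A e v].
  have [e e0 /(_ m) [A A0 hA]] := umap_smap_exist.
  have [_ /(_ zm) [v' hv' cv']] := hA f g z rf rg fg.
  by exists A, e; split => //; rewrite (ucvg_unique hv cv').
have key d : 0 < d -> exists j0, forall j, (j0 <= j)%N -> exists X Y,
    [/\ holo (bw f z) (bw g z) (n + j * l) =
          X \o holo (fw f z) (fw g z) (m + j * l) \o Y,
      uclose (d + d) X id & uclose (d + d) Y id].
  move=> d0; have [j1 H1] := far_small n d0; have [j2 H2] := far_small m d0.
  exists (maxn j1 j2).+1 => j hj; set J := (j * l)%N.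
  have jJ : (j <= J)%N by rewrite leq_pmulr.
  have [j1J j2J J0] : [/\ (j1 <= J)%N, (j2 <= J)%N & (0 < J)%N].
    by clear -hj jJ; split; lia.
  have [nJ hn] := H1 J j1J; have [mJ hm] := H2 J j2J.
  have [||p [pL pz]] := heteroclinic_closing _ _ zn zm (J := J).
  - exact: J0.
  - by move=> i; exact: val_period.
  have Efw f' : regular_cocycle f' ->
      uclose d (holo (fw f' z) (fw f' p) (m + J)) id /\
      uclose d (holo (fw f' p) (fw f' z) (m + J)) id.
    move=> rf'; have hi (i : nat) : (i < m + J)%N ->
        uclose (CM * t ^+ ((J - m) + (m + J - i))) (fw f' z i) (fw f' p i).
      by move=> iJ; apply: fw_agree => //; exact: agree_forward_window.
    split; apply: (uclose_le hm); apply: holo_far => //; try by move=> i; exact: bilip_fw.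
    by move=> i /hi; exact: uclose_sym.
  have Ebw f' : regular_cocycle f' ->
      uclose d (holo (bw f' z) (bw f' p) (n + J)) id /\
      uclose d (holo (bw f' p) (bw f' z) (n + J)) id.
    move=> rf'; have hi (i : nat) : (i < n + J)%N ->
        uclose (CM * t ^+ ((J - n) + (n + J - i))) (bw f' z i) (bw f' p i).
      by move=> iJ; apply: bw_agree => //; exact: agree_backward_window.
    split; apply: (uclose_le hn); apply: holo_far => //; try by move=> i; exact: bilip_bw.
    by move=> i /hi; exact: uclose_sym.
  (* Pass from the past products of [z] to those of [p], cross to the future products of [p] by
     [holo_split], and return to [z]: the first factor collects the changes in [f], the second those
     in [g]. *)
  exists (holo (bw f z) (bw f p) (n + J) \o holo (fw f p) (fw f z) (m + J)).
  exists (holo (fw g z) (fw g p) (m + J) \o holo (bw g p) (bw g z) (n + J)).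
  split.
  - rewrite -(holo_comp (bw f p) (bw f z) (bw g z)).
    rewrite -(holo_comp (bw g p) (bw f p) (bw g z)).
    rewrite (@holo_split f g p (n + J) (m + J)) ?pL//; last first.
      by rewrite addn_gt0 addn_gt0 J0 orbT.
    rewrite -(holo_comp (fw f z) (fw f p) (fw g p)).
    by rewrite -(holo_comp (fw g z) (fw f z) (fw g p)).
  - exact: uclose_trans (uclose_compr _ (Ebw f rf).1) (Efw f rf).2.
  - exact: uclose_trans (uclose_compr _ (Efw g rg).1) (Ebw g rg).2.
apply: uclose0_eq => r; apply/ler_addgt0Pr => eps eps0; rewrite add0r.
have eps2 : 0 < eps / 2 by rewrite divr_gt0.
have [d d0 hd] := holder_small A0 e0 eps2.
(* Both terms of d' + A d'^e are then at most eps / 2. *)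
pose d' := Num.min d (eps / 2).
have d'0 : 0 < d' by rewrite lt_min d0.
have d'2 : 0 < d' / 2 by rewrite divr_gt0.
have hd' : d' / 2 + d' / 2 = d' by lra.
have := key _ d'2; rewrite hd' => /(uclose_conj A0 (ltW e0) hu hv hA) /(_ r).
move=> /le_trans; apply.
have -> : eps = eps / 2 + eps / 2 by lra.
apply: lerD; first by rewrite ge_min lexx orbT.
apply: le_trans hd; rewrite ler_wpM2l//; apply: powR_homo_base; rewrite ?(ltW e0) ?(ltW d'0)//.
by rewrite ge_min lexx.
Qed.

Hypothesis dense : forall x N, exists z (n m : nat),
  [/\ agree x z N, past_at q z n & future_at q z m].

(** Let [x] be the reference point of the symbol z_0 and [y] the point with the past of [x] and the
    future of [z]. The map at [x] is transported to [y] along the past, identified there with the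
    future limit, and transported to [z] along the future. Finitely many symbols leave a single
    constant. *)
Lemma umap_uniform_holder : exists e A : R, [/\ 0 < e, e <= 1, 0 <= A &
  forall f g z n m u, regular_cocycle f -> regular_cocycle g ->
    same_periodic_data f g -> past_at q z n -> future_at q z m ->
    umap f g z n u -> holder_with A e u].
Proof.
have [e1 e10 hex] := umap_smap_exist.
have [e e0 htr] := holo_transport M1 t0 Mt1 G_compact.
have /choice[B hB] : forall s : 'I_k, exists B : R, 0 <= B /\
    forall z, val z 0 = s -> exists x (n m : nat),
    [/\ val x 0 = s, past_at q x n, future_at q x m &
     forall f g, regular_cocycle f -> regular_cocycle g ->
       same_periodic_data f g -> exists2 u, holder_with B e1 u & umap f g x n u].
  (* A symbol that no point carries at time 0 gets the constant 0, vacuously. *)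
  move=> s; have [[z zs]|nz] := pselect (exists z : sft P, val z 0 = s); last first.
    by exists 0; split => // z zs; exfalso; apply: nz; exists z.
  have [x [n [m [zx xn xm]]]] := dense z 1.
  have [B B0 hB] := hex n; exists B; split => // _ _; exists x, n, m; split => //.
    by rewrite -zs zx.
  by move=> f g rf rg fg; case: (hB f g x rf rg fg) => /(_ xn).
pose A0 := \sum_s B s.
have A00 : 0 <= A0 by apply: sumr_ge0 => s _; case: (hB s).
have BA0 s : B s <= A0.
  rewrite /A0 (bigD1 s)//= lerDl; apply: sumr_ge0 => s' _.
  by case: (hB s').
have [A1 A10 h1] := htr CM A0 e1 CM0 A00 e10.
have e20 : 0 < e * e1 * e by rewrite !mulr_gt0.
have [A2 A20 h2] := htr CM A1 _ CM0 A10 e20.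
pose e3 := e * (e * e1 * e) * e.
have e30 : 0 < e3 by rewrite !mulr_gt0.
(* The cap at 1 ensures [t <= t ^ e] when distances between maps at nearby points are estimated. *)
pose e4 := Num.min e3 1.
have e40 : 0 < e4 by rewrite lt_min e30 ltr01.
have e43 : e4 <= e3 by rewrite ge_min lexx.
have [D D0 hD] := holder_exponent_le G_compact e43 e40.
exists e4, (A2 * D); split => //; [by rewrite ge_min lexx orbT|by rewrite mulr_ge0|].
move=> f g z n m u rf rg fg zn zm hu; apply: hD => //.
have [_ /(_ z erefl) [x [n' [m' [xz xn xm /(_ f g rf rg fg) [ux Bux cux]]]]]] := hB (val z 0).
have xz1 : agree x z 1 by move=> [[|i]|i].
have [y [yn ym y1 y2]] := heteroclinic_glue xn zm xz1.
have s (c j : nat) : (j <= c + j * l)%N.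
  by rewrite (leq_trans (leq_pmulr j l0))// leq_addl.
have [Ay Ay0 /(_ f g y rf rg fg) [/(_ yn) [uy _ cuy] _]] := hex n'.
have [Bs Bs0 /(_ f g) hs] := hex m.
have [_ /(_ ym) [sy _ csy]] := hs y rf rg fg.
have [_ /(_ zm) [sz _ csz]] := hs z rf rg fg.
have yx (i : int) : i < 0 -> val y i = val x i by move=> i0; apply: y1; exact: lt_trans i0 _.
have yz (i : int) : 0 < i -> val y i = val z i by move=> i0; apply: y2; exact: lt_trans _ i0.
have hy : holder_with A1 (e * e1 * e) uy.
  apply: (h1 (bw f x) (bw g x) (bw f y) (bw g y) (fun j => n' + j * l)%N ux) => //;
    try by move=> i; exact: bilip_bw.
  - by move=> i; apply: (@bw_half f y x 0 rf).
  - by move=> i; apply: (@bw_half g x y 0 rg) => j j0; rewrite yx.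
  - exact: holder_le (BA0 _) Bux.
rewrite (umap_smap_eq rf rg fg zn zm hu csz).
apply: (h2 (fw f y) (fw g y) (fw f z) (fw g z) (fun j => m + j * l)%N uy) => //;
    try by move=> i; exact: bilip_fw.
- by move=> i; apply: (@fw_half f z y 0 rf) => j j0; rewrite yz// -oppr0.
- by move=> i; apply: (@fw_half g y z 0 rg) => j j0; rewrite yz// -oppr0.
- by rewrite (umap_smap_eq rf rg fg yn ym cuy csy).
Qed.

(** The bracket [z] of [x] and [y] is compared with [x] through past products and with [y] through
    future ones. The holonomies are K t^N-close to the identity, and [uclose_conj] turns this into
    order (t^e)^N. *)
Lemma umap_uniform_close (e A : R) : 0 < e -> e <= 1 -> 0 <= A ->
  (forall f g z n m u, regular_cocycle f -> regular_cocycle g ->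
    same_periodic_data f g -> past_at q z n -> future_at q z m ->
    umap f g z n u -> holder_with A e u) ->
  exists2 B : R, 0 <= B & forall f g x y n m n' m' u v N,
    regular_cocycle f -> regular_cocycle g -> same_periodic_data f g ->
    past_at q x n -> future_at q x m -> past_at q y n' -> future_at q y m' ->
    umap f g x n u -> umap f g y n' v -> agree x y N ->
    uclose (B * (t `^ e) ^+ N) u v.
Proof.
move=> e0 e1 A0 hA; have [D D1 hD] := compact_diameter G_compact.
have [ex ex0 hex] := umap_smap_exist.
pose K := CM * M / (1 - M * t).
have K0 : 0 <= K.
  by rewrite !mulr_ge0 ?invr_ge0 ?(ltW M0) ?subr_ge0 ?(ltW Mt1).
pose B := K + A * K `^ e.
have B0 : 0 <= B by apply: addr_ge0 => //; rewrite mulr_ge0 ?powR_ge0.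
have D0 : 0 <= D by apply: le_trans D1.
have BB0 : 0 <= B + B by exact: addr_ge0.
exists (D + (B + B)); first exact: addr_ge0.
(* For radius 0 the symbols at 0 may differ and no bracket exists; the diameter is the bound. *)
move=> f g x y n m n' m' u v [|N] rf rg fg xn xm yn ym hu hv xy.
  by move=> p; apply: (le_trans (hD _ _)); rewrite expr0 mulr1 lerDl.
have [z [zn zm zx zy]] := heteroclinic_glue xn ym xy.
have [A'' _ /(_ f g z rf rg fg) [/(_ zn) [w _ hw] _]] := hex n.
have [A' _ /(_ f g) hs] := hex m'.
have [_ /(_ zm) [w' _ hw']] := hs z rf rg fg.
have [_ /(_ ym) [v' _ hv']] := hs y rf rg fg.
have ew : w = w' := umap_smap_eq rf rg fg zn zm hw hw'.
have ev : v = v' := umap_smap_eq rf rg fg yn ym hv hv'.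
have step : K * t ^+ N.+1 + A * (K * t ^+ N.+1) `^ e <= B * (t `^ e) ^+ N.+1.
  rewrite powRM ?exprn_ge0 ?(ltW t0)// powR_exprn ?(ltW t0)// mulrDl.
  rewrite mulrA lerD2r ler_wpM2l// lerXn2r ?nnegrE ?powR_ge0 ?(ltW t0)//.
  rewrite -[leLHS](powRr1 (ltW t0)); apply: ger_powR => //.
  by rewrite t0 ltW.
have hwu : uclose (B * (t `^ e) ^+ N.+1) w u.
  apply: (uclose_le step); apply: (uclose_conj A0 (ltW e0) hw hu).
    exact: hA xn xm hu.
  exists 0%N => j _.
  exists (holo (bw f z) (bw f x) (n + j * l)), (holo (bw g x) (bw g z) (n + j * l)).
  split; first by rewrite (holo_comp (bw f x)) (holo_comp (bw g x)).
    by apply: holo_near => // i; [exact: bilip_bw|move=> _; apply: bw_half].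
  apply: holo_near => // i; [exact: bilip_bw|move=> _; apply: bw_half => // i' hi'].
  by rewrite zx.
have hwv : uclose (B * (t `^ e) ^+ N.+1) w v.
  rewrite ew ev.
  apply: (uclose_le step); apply: (uclose_conj A0 (ltW e0) hw' hv').
    by rewrite -ev; exact: hA yn ym hv.
  exists 0%N => j _.
  exists (holo (fw f z) (fw f y) (m' + j * l)), (holo (fw g y) (fw g z) (m' + j * l)).
  split; first by rewrite (holo_comp (fw f y)) (holo_comp (fw g y)).
    by apply: holo_near => // i; [exact: bilip_fw|move=> _; apply: fw_half].
  apply: holo_near => // i; [exact: bilip_fw|move=> _; apply: fw_half => // i' hi'].
  by rewrite zy.
apply: uclose_le (uclose_trans (uclose_sym hwu) hwv).
by rewrite -mulrDl ler_wpM2r ?exprn_ge0 ?powR_ge0// lerDr.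
Qed.

(** * Equivariance and extension to the whole subshift *)

Lemma umapK f g z n m u v : regular_cocycle f -> regular_cocycle g ->
  same_periodic_data f g -> past_at q z n -> future_at q z m ->
  umap f g z n u -> umap g f z n v -> u \o v = id.
Proof.
move=> rf rg fg zn zm hu hv.
have [e [A [e0 _ A0 hA]]] := umap_uniform_holder.
have := ucvg_comp A0 e0 (hA _ _ _ _ _ _ rf rg fg zn zm hu) hu hv.
move=> /ucvg_unique; apply; apply: ucvg_ext (@ucvg_cst _ _ id) => j.
by apply/funext => p /=; rewrite holoK.
Qed.

(** The first backward factors at the shifted point are the inverses of f_z and g_z; peeling them
    off leaves the product at [z]. This is the conjugacy equation at [z]. *)
Lemma umap_shift f g z n u : regular_cocycle f -> regular_cocycle g ->
  umap f g z n u -> (exists e A : R, [/\ 0 < e, 0 <= A & holder_with A e u]) ->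
  umap f g (sh 1 z) n.+1 (f z \o (u \o homeo_inv (g z))).
Proof.
move=> rf rg hu [e [A [e0 A0 hA]]].
have hf : holder_with M 1 (f z) by apply: lip_holder; case: rf => /(_ z) [].
apply: (@ucvg_ext _ _ (fun j => f z \o
  (holo (bw f z) (bw g z) (n + j * l) \o homeo_inv (g z)))).
  have E h : (fun i => bw h (sh 1 z) (1 + i)%N) = bw h z.
    apply/funext => i; rewrite /bw sh_sh; congr (homeo_sym (h (sh _ _))).
    by clear; lia.
  have E0 h : sh (- 1%N%:Z) (sh 1 h) = h by rewrite sh_sh addNr sh0.
  move=> j; rewrite addSn -add1n (holoD (bw f (sh 1 z)) (bw g (sh 1 z)) 1).
  by rewrite !E /= /bw !E0.
apply: (ucvg_comp (ltW M0) ltr01 hf (@ucvg_cst _ _ _)).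
by apply: (ucvg_comp A0 e0 hA hu); exact: ucvg_cst.
Qed.

Lemma future_at_shift z m : future_at q z m -> exists m', future_at q (sh 1 z) m'.
Proof.
(* The phase drops by one; a period is added first because [m] may be 0. *)
move=> zm; exists (m + l).-1 => i i0; rewrite shE -(val_period 1 i) mul1n -zm.
  by congr (val z _); clear -l0; lia.
by clear -i0; lia.
Qed.

Lemma past_at_shift z n : past_at q z n -> past_at q (sh 1 z) n.+1.
Proof.
move=> zn i i0; rewrite shE -zn//; congr (val z _); clear; lia.
Qed.

Lemma regular_ucvg f x (zs : nat -> sft P) : regular_cocycle f ->
  (forall N, agree x (zs N) N) ->
  ucvg (fun N => f (zs N)) (f x) /\
  ucvg (fun N => homeo_inv (f (zs N))) (homeo_inv (f x)).
Proof.
move=> [h1 h2] hz; have t01 : 0 <= t < 1 by rewrite (ltW t0).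
have hc N : uclose (C * t ^+ N) (f (zs N)) (f x).
  by apply: uclose_sym; apply: h2.
split; first exact: ucvg_geometric hc.
apply: (ucvg_geometric CM0 t01) => N.
rewrite /CM mulrAC mulrC; exact: uclose_homeo_inv (ltW M0) (h1 _) (hc N).
Qed.

(** [Phi x] is the limit of the maps at asymptotic points agreeing with [x] up to radius N, a
    geometric Cauchy sequence by [umap_uniform_close]; [Psi x] is built at the same points with [f]
    and [g] exchanged. *)
Lemma conjugacy_exists f g : regular_cocycle f -> regular_cocycle g ->
  same_periodic_data f g ->
  exists e A B : R, [/\ 0 < e, 0 <= A, 0 <= B &
  exists Phi Psi : sft P -> G -> G,
    [/\ forall x, holder_with A e (Phi x) /\ holder_with A e (Psi x),
        forall x, Psi x \o Phi x = id /\ Phi x \o Psi x = id,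
        forall x y N, agree x y N ->
          uclose (B * (t `^ e) ^+ N) (Phi x) (Phi y) &
        forall x, Phi (sh 1 x) = f x \o (Phi x \o homeo_inv (g x))]].
Proof.
move=> rf rg fg; have gf := same_periodic_data_sym fg.
have [e [A [e0 e1 A0 hA]]] := umap_uniform_holder.
have [B B0 hB] := umap_uniform_close e0 e1 A0 hA.
have [ex _ hex] := umap_smap_exist.
pose kap := t `^ e.
have kap0 : 0 < kap by rewrite powR_gt0.
have kap1 : kap < 1.
  rewrite /kap /powR gt_eqF// -expR0 ltr_expR.
  by rewrite pmulr_rlt0// ln_lt0// t0.
have kap01 : 0 <= kap < 1 by rewrite (ltW kap0).
(* The chosen data are a point, its two phases, and its maps for (f, g) and for (g, f). *)
have /choice[Z hZ] : forall xN : sft P * nat,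
    exists Z : sft P * (nat * nat) * ((G -> G) * (G -> G)),
    [/\ agree xN.1 Z.1.1 xN.2, past_at q Z.1.1 Z.1.2.1, future_at q Z.1.1 Z.1.2.2,
      umap f g Z.1.1 Z.1.2.1 Z.2.1 & umap g f Z.1.1 Z.1.2.1 Z.2.2].
  move=> [x N] /=; have [z [n [m [xz zn zm]]]] := dense x N.
  have [A' _ hA'] := hex n.
  have [/(_ zn) [u _ hu] _] := hA' f g z rf rg fg.
  have [/(_ zn) [v _ hv] _] := hA' g f z rg rf gf.
  by exists (z, (n, m), (u, v)).
pose zs x N := (Z (x, N)).1.1.
pose us x N := (Z (x, N)).2.1.
pose vs x N := (Z (x, N)).2.2.
have zsP x N : agree x (zs x N) N by case: (hZ (x, N)).
have zs2 x y N N' K : agree x y K -> (K <= N)%N -> (K <= N')%N ->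
    agree (zs x N) (zs y N') K.
  move=> xy KN KN'; apply: (@agree_trans _ _ x).
    by apply: agree_sym; apply: agree_mono KN (zsP x N).
  by apply: (agree_trans xy); apply: agree_mono KN' (zsP y N').
have usC x y N N' K : agree (zs x N) (zs y N') K ->
    uclose (B * kap ^+ K) (us x N) (us y N').
  have [_ p1 f1 u1 _] := hZ (x, N); have [_ p2 f2 u2 _] := hZ (y, N').
  exact: hB p1 f1 p2 f2 u1 u2.
have vsC x y N N' K : agree (zs x N) (zs y N') K ->
    uclose (B * kap ^+ K) (vs x N) (vs y N').
  have [_ p1 f1 _ v1] := hZ (x, N); have [_ p2 f2 _ v2] := hZ (y, N').
  exact: hB p1 f1 p2 f2 v1 v2.
have usA x N : holder_with A e (us x N).
  by have [_ p1 f1 u1 _] := hZ (x, N); exact: hA p1 f1 u1.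
have vsA x N : holder_with A e (vs x N).
  by have [_ p1 f1 _ v1] := hZ (x, N); exact: hA p1 f1 v1.
have /choice[Phi hPhi] x := geometric_ucvg G_compact B0 kap01
  (fun N => @usC x x N N.+1 N (@zs2 x x _ _ _ (fun=> fun=> erefl) (leqnn _) (leqnSn _))).
have /choice[Psi hPsi] x := geometric_ucvg G_compact B0 kap01
  (fun N => @vsC x x N N.+1 N (@zs2 x x _ _ _ (fun=> fun=> erefl) (leqnn _) (leqnSn _))).
have B10 : 0 <= B / (1 - kap).
  by rewrite divr_ge0// subr_ge0 ltW.
have cPhi x : ucvg (us x) (Phi x) := ucvg_geometric B10 kap01 (hPhi x).
have cPsi x : ucvg (vs x) (Psi x) := ucvg_geometric B10 kap01 (hPsi x).
have hAPhi x : holder_with A e (Phi x) := holder_ucvg (cPhi x) (usA x).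
have hAPsi x : holder_with A e (Psi x) := holder_ucvg (cPsi x) (vsA x).
(* Two tails of the limits and the distance between the approximants. *)
exists e, A, (B / (1 - kap) + B + B / (1 - kap)); split => //.
  by apply: addr_ge0 => //; apply: addr_ge0.
exists Phi, Psi; split => //.
- move=> x; split.
    have := ucvg_comp A0 e0 (hAPsi x) (cPsi x) (cPhi x).
    move=> /ucvg_unique; apply; apply: ucvg_ext (@ucvg_cst _ _ id) => N.
    by have [_ p1 f1 u1 v1] := hZ (x, N); rewrite (umapK rg rf gf p1 f1 v1 u1).
  have := ucvg_comp A0 e0 (hAPhi x) (cPhi x) (cPsi x).
  move=> /ucvg_unique; apply; apply: ucvg_ext (@ucvg_cst _ _ id) => N.
  by have [_ p1 f1 u1 v1] := hZ (x, N); rewrite (umapK rf rg fg p1 f1 u1 v1).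
- move=> x y N xy; rewrite !mulrDl -/kap.
  apply: uclose_trans (hPhi y N); apply: uclose_trans (uclose_sym (hPhi x N)) _.
  by apply: usC; exact: zs2.
(* Compare the approximant of s(x) with the shift of the approximant of x, whose map is given by
   [umap_shift]. The two points agree around s(x), with one unit of radius lost to the shift. *)
move=> x; apply: uclose0_eq.
have [cf _] := regular_ucvg rf (zsP x).
have [_ cg] := regular_ucvg rg (zsP x).
have hf : holder_with M 1 (f x) by apply: lip_holder; case: rf => /(_ x) [].
have c2 := ucvg_comp (ltW M0) ltr01 hf cf (ucvg_comp A0 e0 (hAPhi x) (cPhi x) cg).
apply: (ucvg_close (cPhi (sh 1 x)) c2) => d d0.
have [N0 HN0] := geometric_small B0 kap01 d0.
exists N0.+1 => -[//|N]; rewrite ltnS => /HN0 hN.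
have [_ p1 f1 u1 _] := hZ (x, N.+1).
have [_ p2 f2 u2 _] := hZ (sh 1 x, N.+1).
have [m' f1'] := future_at_shift f1.
have u1' := umap_shift rf rg u1 (ex_intro _ e (ex_intro _ A (And3 e0 A0 (usA x N.+1)))).
rewrite add0r; apply: (uclose_le hN).
apply: (hB _ _ _ _ _ _ _ _ _ _ N rf rg fg p2 f2 (past_at_shift p1) f1' u2 u1').
apply: (@agree_trans _ _ (sh 1 x)).
  by apply: agree_sym; apply: agree_mono (leqnSn N) (zsP _ _).
move=> i iN; rewrite !shE; apply: (zsP x N.+1).
by clear -iN; lia.
Qed.

End CocycleProducts.

(** * The conjugacy *)

Lemma powR_exprVn (R : realType) (x b : R) n : 0 <= x ->
  (x ^- n) `^ b = (x `^ (- b)) ^+ n.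
Proof.
move=> x0; rewrite -(powR_invn n x0) -(powR_mulrn n (powR_ge0 x (- b))) -!powRrM.
by congr (x `^ _); ring.
Qed.

Section FibreMetrics.
Variables (R : realType) (G : metricGroupType R).
Implicit Types (u v : G -> G).

Lemma lip_const_lt u (K : R) : (lip_const u < K%:E)%E -> lip_with K u.
Proof.
move=> /ereal_inf_lt [_ [K' [K'0 hK'] <-]]; rewrite lte_fin => /ltW KK'.
exact: lip_le KK' hK'.
Qed.

Lemma dist_lip_uclose u v (K : R) : (dist_lip u v <= K%:E)%E -> uclose K u v.
Proof.
move=> h p; rewrite -lee_fin; apply: le_trans h.
apply: (@le_trans _ _ (dist_sup u v)).
  by apply: ereal_sup_ubound; exists p.
apply: leeDl; apply: le_ereal_inf_tmp => _ [K' [K'0 _] <-].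
by rewrite lee_fin.
Qed.

Lemma uclose_dist_sup u v (K : R) : uclose K u v -> (dist_sup u v <= K%:E)%E.
Proof. by move=> h; apply: ge_ereal_sup => _ [p _ <-]; rewrite lee_fin. Qed.

Lemma holder_continuous (A e : R) u : 0 <= A -> 0 < e -> holder_with A e u -> continuous u.
Proof.
move=> A0 e0 hu p; apply/cvg_ballP => eps eps0.
have eps2 : 0 < eps / 2 by rewrite divr_gt0.
have [d d0 hd] := holder_small A0 e0 eps2.
apply: filterS (nbhsx_ballx p d d0) => r; rewrite !ballEmdist /= => pr.
apply: (le_lt_trans (hu _ _)); apply: (@le_lt_trans _ _ (eps / 2)); last by lra.
apply: le_trans hd; rewrite ler_wpM2l//; apply: powR_homo_base; rewrite ?(ltW e0) ?(ltW pr)//.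
exact: mdist_ge0.
Qed.

End FibreMetrics.

(** The freedom in [C'] and [theta'] lets [f] and [g] share their constants. *)
Lemma holder_cocycle_regular (R : realType) (G : metricGroupType R) (k : nat)
    (P : 'M[bool]_k) (rho alpha theta : R) (f : sft P -> homeo G) :
  1 < rho -> 0 < alpha ->
  holder (sft_dist rho) (fun u v : homeo G => dist_lip u v) alpha f ->
  (forall x, (lip_const (homeo_inv (f x)) < (rho `^ (alpha - theta))%:E)%E /\
             (lip_const (f x) < (rho `^ (alpha - theta))%:E)%E) ->
  exists2 C : R, 0 <= C & forall C' theta', C <= C' -> theta' <= theta ->
    regular_cocycle (rho `^ (alpha - theta')) (rho `^ (- alpha)) C' f.
Proof.
move=> rho1 alpha0 [C hC] hth; have rho0 : 0 < rho by exact: lt_trans rho1.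
exists `|C| => // C' theta' CC' tt'; split.
  have hM : rho `^ (alpha - theta) <= rho `^ (alpha - theta').
    by apply: ler_powR; [exact: ltW|rewrite lerD2l lerN2].
  by move=> x; have [/lip_const_lt h1 /lip_const_lt h2] := hth x; split;
    [exact: lip_le hM h2|exact: lip_le hM h1].
move=> x y N xy; apply: uclose_le (dist_lip_uclose (hC x y)).
have /andP[d0 dN] := sft_dist_agree rho1 xy.
have -> : (rho `^ (- alpha)) ^+ N = (rho ^- N) `^ alpha.
  by rewrite powR_exprVn// ltW.
apply: (@le_trans _ _ (C' * sft_dist rho x y `^ alpha)).
  by rewrite ler_wpM2r ?powR_ge0// (le_trans (ler_norm C)).
rewrite ler_wpM2l ?(le_trans (normr_ge0 C))//.
exact: powR_homo_base (ltW alpha0) d0 dN.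
Qed.

Theorem theorem1 (R : realType) (G : metricGroupType R)
  (G_compact : compact [set: G])
  (k : nat) (P : 'M[bool]_k)
  (P_rows : forall i : 'I_k, exists j : 'I_k, P i j)
  (rho : R) (rho_gt1 : 1 < rho)
  (transitive : topologically_transitive (sft_dist rho) (@sft_shift k P))
  (alpha : R) (alpha_gt0 : 0 < alpha) (alpha_le1 : alpha <= 1)
  (f g : sft P -> homeo G)
  (f_holder : holder_cocycle rho alpha f)
  (g_holder : holder_cocycle rho alpha g)
  (f_dominated : su_dominated rho alpha f)
  (g_dominated : su_dominated rho alpha g)
  (periodic_data : forall (n : nat) (x0 : sft P), (1 <= n)%N ->
    iter n (@sft_shift k P) x0 = x0 ->
    cocycle_iter f n x0 = cocycle_iter g n x0) :
  exists beta : R, [/\ 0 < beta, beta < alpha ^+ 2 &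
    exists phi : sft P -> homeo G,
      [/\ forall x, holder_homeo beta (phi x),
          holder (sft_dist rho) (fun u v : homeo G => dist_sup u v) beta phi &
          forall x, homeo_fun (f x) =
            homeo_fun (phi (sft_shift x)) \o homeo_fun (g x)
              \o homeo_inv (phi x)]].
Proof.
have a20 : 0 < alpha ^+ 2 / 2 by rewrite divr_gt0 ?exprn_gt0.
have a2 : alpha ^+ 2 / 2 < alpha ^+ 2.
  by rewrite ltr_pdivrMr// ltr_pMr ?exprn_gt0// ltr1n.
(* Over an empty subshift there is no periodic point to start from, but everything is vacuous and
   [f] itself serves as phi. *)
have [[x0 _]|h0] := pselect (exists x : sft P, True); last first.
  exists (alpha ^+ 2 / 2); split => //; exists f.
  by split=> [x||x]; [|exists 0 => x|]; exfalso; apply: h0; exists x.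
have [q [l [l0 ql]]] := sft_periodic_point x0.
have dense x N := heteroclinic_dense rho_gt1 transitive q x N.
have rho0 : 0 < rho by exact: lt_trans rho_gt1.
have [thf thf0 hf] := f_dominated; have [thg thg0 hg] := g_dominated.
have [Cf Cf0 rf] := holder_cocycle_regular rho_gt1 alpha_gt0 f_holder.2 hf.
have [Cg Cg0 rg] := holder_cocycle_regular rho_gt1 alpha_gt0 g_holder.2 hg.
(* The bound [alpha / 2] keeps alpha - theta positive, hence [M > 1]. *)
pose theta := Num.min (Num.min thf thg) (alpha / 2).
have theta0 : 0 < theta by rewrite !lt_min thf0 thg0 divr_gt0.
have theta_a : theta <= alpha / 2 by rewrite ge_min lexx orbT.
have theta_f : theta <= thf by rewrite !ge_min lexx.
have theta_g : theta <= thg by rewrite !ge_min lexx orbT.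
have {}rf := rf (Cf + Cg) theta (ltac:(by rewrite lerDl)) theta_f.
have {}rg := rg (Cf + Cg) theta (ltac:(by rewrite lerDr)) theta_g.
set M := rho `^ (alpha - theta) in rf rg.
set t := rho `^ (- alpha) in rf rg.
have pow_lt1 c : 0 < c -> 1 < rho `^ c.
  move=> c0; rewrite /powR gt_eqF// -expR0 ltr_expR mulr_gt0// ln_gt0//.
have M1 : 1 < M by apply: pow_lt1; lra.
have t0 : 0 < t by rewrite powR_gt0.
have Mt1 : M * t < 1.
  rewrite /M /t -powRD; last by rewrite (gt_eqF rho0) implybT.
  have -> : alpha - theta - alpha = - theta by lra.
  by rewrite powRN invf_lt1 ?powR_gt0// pow_lt1.
have C0 : 0 <= Cf + Cg by exact: addr_ge0.
have [e [A [B [e0 A0 B0 [Phi [Psi [hhold hK hclose heq]]]]]]] :=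
  conjugacy_exists M1 t0 Mt1 C0 l0 ql G_compact dense rf rg periodic_data.
have ea0 : 0 < e * alpha by rewrite mulr_gt0.
(* Since t^e = rho^(-e alpha), the base regularity is [e * alpha]; the fibre exponent [e] is at
   least that because alpha <= 1. The second term secures the strict bound beta < alpha^2. *)
pose beta := Num.min (e * alpha) (alpha ^+ 2 / 2).
have beta0 : 0 < beta by rewrite lt_min ea0.
have beta_ea : beta <= e * alpha by rewrite ge_min lexx.
have beta_e : beta <= e.
  by apply: (le_trans beta_ea); rewrite ler_piMr// ltW.
have [D D0 hD] := holder_exponent_le G_compact beta_e beta0.
exists beta; split => //.
  by apply: le_lt_trans a2; rewrite ge_min lexx orbT.
pose phi x := @Homeo _ _ (Phi x) (Psi x) (fun p => congr1 (@^~ p) (hK x).1)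
  (fun p => congr1 (@^~ p) (hK x).2)
  (holder_continuous A0 e0 (hhold x).1) (holder_continuous A0 e0 (hhold x).2).
exists phi; split.
- by move=> x; split; exists (A * D) => p r; rewrite lee_fin; apply: hD => //;
    case: (hhold x).
- exists B => x y; apply: uclose_dist_sup.
  have [<-|[N -> xy]] := sft_distP rho x y.
    by apply: uclose_le (uclose_refl _); rewrite mulr_ge0 ?powR_ge0.
  apply: uclose_le (hclose x y N xy); rewrite ler_wpM2l//.
  have -> : t `^ e = rho `^ (- (e * alpha)).
    by rewrite /t -powRrM; congr (rho `^ _); ring.
  rewrite -powR_exprVn ?(ltW rho0)//; apply: ger_powR => //.
  by rewrite invr_gt0 exprn_gt0//= invf_le1 ?exprn_gt0// exprn_ege1// ltW.
- move=> x /=; rewrite sft_shiftE heq; apply/funext => p /=.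
  by rewrite homeo_funK; have /= -> := congr1 (@^~ p) (hK x).2.
Qed.
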